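(* Let $X_i$, $i=1,\ldots,n$, be independent mean zero random variables with variances $\sigma_i^2=\mathrm{Var}(X_i)$ satisfying $\sum_{i=1}^n\sigma_i^2=1$, and let $W=\sum_{i=1}^nX_i$. Then, for $F$ the distribution function of $W$ and $\Phi$ that of the standard normal, $$\|F-\Phi\|_1\le 2E|X_I^*-X_I|,$$ where, for each $i=1,\ldots,n$, $X_i^*$ is any variable (on the same probability space) having the $X_i$-zero biased distribution, independent of $\{X_j,\,j\ne i\}$, and $I$ is a random index, independent of $\{X_i,X_i^*,\ i=1,\ldots,n\}$, with distribution $P(I=i)=\sigma_i^2$. Letting $G_i$ and $G_i^*$ be the distribution functions of $X_i$ and $X_i^*$, respectively, $$\|F-\Phi\|_1\le 2\sum_{i=1}^n\sigma_i^2\|G_i^*-G_i\|_1.$$ In particular, when $X,X_1,\ldots,X_n$ are i.i.d. with mean zero, variance $1$ and distribution function $G$, and $F$ is now the distribution function of $W=n^{-1/2}\sum_{i=1}^nX_i$, $$\|F-\Phi\|_1\le\frac{2}{\sqrt n}\|G^*-G\|_1,$$ where $G^*$, the distribution function of a variable $X^*$ having the $X$-zero biased distribution, is given explicitly by $$G^*(x)=E[X(X-x)\mathbf{1}(X\le x)].$$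
   Context: For distribution functions $F,G$ on $\mathbf{R}$, $\|F-G\|_1=\int_{-\infty}^\infty|F(t)-G(t)|\,dt$. Zero biased distribution: for a mean zero random variable $W$ with finite variance $\sigma^2$, a random variable $W^*$ has the $W$-zero biased distribution if $E[Wf(W)]=\sigma^2E[f'(W^* )]$ for all absolutely continuous $f$ with $E|Wf(W)|<\infty$ and $E|f'(W^* )|<\infty$. Such a $W^*$ exists for every such $W$; for $\sigma^2>0$ its distribution is uniquely determined. (When $\sigma_i^2=0$ the $i$th term of the sum is read as $0$.) *)

(* Defs.v *)
From HB Require Import structures.
From mathcomp Require Import all_boot all_order all_algebra.
From mathcomp Require Import all_classical all_reals all_analysis.

Set Implicit Arguments.
Unset Strict Implicit.
Unset Printing Implicit Defensive.

Import Order.TTheory GRing.Theory Num.Theory.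
Import numFieldNormedType.Exports.

Local Open Scope classical_set_scope.
Local Open Scope ring_scope.
Local Open Scope ereal_scope.

(** The [cdf] of the library is extended-real valued, so distribution functions
    have type [R -> \bar R] throughout. *)
Definition L1dist (R : realType) (F G : R -> \bar R) : \bar R :=
  \int[lebesgue_measure]_t `|F t - G t|.

Definition std_normal_cdf (R : realType) (t : R) : \bar R :=
  normal_prob 0 1 `]-oo, t].

Definition abs_continuous_on (R : realType) (a b : R) (f : R -> R) : Prop :=
  forall e : R, (0 < e)%R -> exists2 d : R, (0 < d)%R &
    forall (m : nat) (u v : 'I_m -> R),
      (forall k, a <= u k /\ u k <= v k /\ v k <= b)%R ->
      trivIset [set: 'I_m] (fun k => `]u k, v k[%classic) ->
      (\sum_(k < m) (v k - u k) < d)%R ->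
      (\sum_(k < m) `|f (v k) - f (u k)| < e)%R.

(** For functions on the whole line, absolute continuity is understood on every
    compact interval. *)
Definition abs_continuous (R : realType) (f : R -> R) : Prop :=
  forall a b : R, abs_continuous_on a b f.

(** [Wstar] may live on a different probability space than [W]. The derivative
    [derive1 f] exists Lebesgue-almost everywhere and takes a default value
    elsewhere; this choice is immaterial, since the zero biased law has a
    Lebesgue density as soon as the variance is nonzero. *)
Definition zero_biased (R : realType)
    (d : measure_display) (T : measurableType d) (P : probability T R)
    (d' : measure_display) (T' : measurableType d') (P' : probability T' R)
    (W : {RV P >-> R}) (Wstar : {RV P' >-> R}) : Prop :=
  forall f : R -> R, abs_continuous f ->
    P.-integrable [set: T] (fun w => (W w * f (W w))%:E) ->
    P'.-integrable [set: T'] (fun w => (derive1 f (Wstar w))%:E) ->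
    'E_P[fun w => (W w * f (W w))%R] =
      'V_P[W] * 'E_P'[fun w => derive1 f (Wstar w)].

Definition mutually_independent (R : realType)
    (d : measure_display) (T : measurableType d) (P : probability T R)
    (I : finType) (X : I -> {RV P >-> R}) : Prop :=
  forall (A : {set I}) (B : I -> set R),
    (forall i, i \in A -> measurable (B i)) ->
    P (\bigcap_(i in [set` A]) (X i @^-1` B i)) =
      \prod_(i in A) P (X i @^-1` B i).

Definition sigma_family (R : realType) (d : measure_display)
    (T : measurableType d) (K : Type) (D : set K) (Y : K -> T -> R) :
    set (set T) :=
  <<s \bigcup_(k in D) preimage_set_system [set: T] (Y k) measurable >>.

Definition independent_classes (R : realType)
    (d : measure_display) (T : measurableType d) (P : probability T R)
    (F G : set (set T)) : Prop :=
  forall A B, F A -> G B -> P (A `&` B) = P A * P B.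

(** [Xstar] is independent of the whole family [(Y k)_(k in D)], jointly. *)
Definition independent_of_family (R : realType)
    (d : measure_display) (T : measurableType d) (P : probability T R)
    (K : Type) (Xstar : {RV P >-> R}) (D : set K) (Y : K -> {RV P >-> R}) :
    Prop :=
  independent_classes P
    (preimage_set_system [set: T] Xstar measurable)
    (sigma_family D (fun k => Y k : T -> R)).

(** A random index is a map to ['I_n] with its discrete sigma-algebra. *)
Definition random_index (d : measure_display) (T : measurableType d) (n : nat)
    (J : T -> 'I_n) : Prop :=
  forall A : set 'I_n, measurable (J @^-1` A).

Definition index_independent_of_family (R : realType)
    (d : measure_display) (T : measurableType d) (P : probability T R)
    (n : nat) (J : T -> 'I_n) (K : Type) (Y : K -> {RV P >-> R}) : Prop :=
  independent_classes P
    [set J @^-1` A | A in [set: set 'I_n]]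
    (sigma_family [set: K] (fun k => Y k : T -> R)).

(** Laws are compared on measurable sets only: the value of a measure on a
    non-measurable set carries no information. *)
Definition same_law (R : realType)
    (d : measure_display) (T : measurableType d) (P : probability T R)
    (X Y : {RV P >-> R}) : Prop :=
  forall B : set R, measurable B -> distribution P X B = distribution P Y B.

(* Main.v *)
Require Import Defs.
From HB Require Import structures.
From mathcomp Require Import all_boot all_order all_algebra.
From mathcomp Require Import all_classical all_reals all_analysis.
From mathcomp Require Import measurable_realfun.
From mathcomp Require Import ring lra.

Set Implicit Arguments.
Unset Strict Implicit.
Unset Printing Implicit Defensive.

Import Order.TTheory GRing.Theory Num.Theory.
Import numFieldNormedType.Exports.

Local Open Scope classical_set_scope.
Local Open Scope ring_scope.

(** Stein's method. For measurable [s] with [|s| <= 1], let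
    [H x = \int s t * (Phi t - (x <= t)) dt]; for [s] the sign of [Phi - F],
    [E H(W) = ||F - Phi||_1]. The Stein equation [f' x - x f x = H x] has the
    solution [f x = \int s t * q x t dt] with the explicit kernel
    [q x t = - Phi (min x t) (1 - Phi (max x t)) / phi x], so
    [||F - Phi||_1 = E (f'(W) - W f(W))]. Writing [W = X_i + V_i] with [V_i]
    independent of [X_i], the zero bias identity for [x |-> f (x + V_i)] turns
    this into [sum_i sigma_i^2 E (f'(X_i + V_i) - f'(X_i^* + V_i))], where
    [X_i^*] enters through its law only; since [f'] is [2]-Lipschitz, the [i]-th
    term is at most [2 sigma_i^2 ||G_i^* - G_i||_1]. The bound through a random
    index follows from [||G_i^* - G_i||_1 <= E |X_i^* - X_i|]. *)

(** * The standard normal distribution *)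

(** Since [s] is merely measurable, [H] is only Lipschitz and [f'] need not be differentiable
    everywhere. The Lipschitz bound for [f'] is therefore obtained by comparing increments of
    integral kernels instead of estimating [f'']; the constant [2] is that of the classical estimate
    [|f''| <= 2 |H'|], with [|H'| <= 1].

    Passing to distribution functions uses no coupling: [E f(X) - f 0] is an integral of [f']
    against [(0 <= t) - cdf X t], so variables on different probability spaces can be compared.

    A scale [c] in front of the sum lets one estimate serve the general and the i.i.d. case. It
    enters each term as [c ^+ 3]: once through the summand [c * X i], twice through the Lipschitz
    constant of the derivative of the test function. For [c = n^(-1/2)] the [n] terms [2 * c ^+ 3]
    add up to [2 / sqrt n].

    A summand of variance [0] leaves its zero biased variable arbitrary, possibly at infinite
    distance; the convention [0 * +oo = 0] makes such terms vanish. *)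

Section std_normal.
Context {R : realType}.
Local Notation mu := (@lebesgue_measure R).
Local Notation phi := (@normal_pdf R 0 1).

Definition Phi (x : R) : R := fine (std_normal_cdf x).

Lemma PhiE (x : R) : (Phi x)%:E = std_normal_cdf x.
Proof. by rewrite fineK// fin_num_measure. Qed.

Lemma std_normal_pdfE (x : R) :
  phi x = normal_peak 1 * expR (- x ^+ 2 / 2).
Proof.
by rewrite normal_pdfE ?oner_neq0// /normal_fun subr0 expr1n.
Qed.

Lemma std_normal_pdf_gt0 (x : R) : 0 < phi x.
Proof. by rewrite std_normal_pdfE mulr_gt0 ?expR_gt0 ?normal_peak_gt0 ?oner_neq0. Qed.

Lemma std_normal_pdfN (x : R) : phi (- x) = phi x.
Proof. by rewrite !std_normal_pdfE sqrrN. Qed.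

Lemma is_derive_std_normal_pdf (x : R) : is_derive x 1 phi (- x * phi x).
Proof.
have -> : phi = fun x => normal_peak 1 * expR (- x ^+ 2 / 2).
  by apply/funext => y; exact: std_normal_pdfE.
apply: is_derive_eq.
by rewrite /GRing.scale/=; field.
Qed.

Lemma is_derive_Phi (x : R) : is_derive x 1 Phi (phi x).
Proof.
have [] := @continuous_FTC1 R phi (BInfty R true) x (x + 1) _ _ _ _.
- by rewrite ltrDl.
- apply: integrableS (integrable_normal_pdf 0 1) => //.
- by rewrite ltNyr.
- exact: continuous_normal_pdf (oner_neq0 _) _.
move=> dPhi dPhiE; apply: DeriveDef; first exact: dPhi.
by rewrite -derive1E dPhiE.
Qed.

Lemma Phi_ge0 (x : R) : 0 <= Phi x.
Proof. by rewrite -lee_fin PhiE. Qed.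

Lemma Phi_le1 (x : R) : Phi x <= 1.
Proof. by rewrite -lee_fin PhiE probability_le1. Qed.

Lemma Phi_nd (x y : R) : x <= y -> Phi x <= Phi y.
Proof.
move=> xy; rewrite -lee_fin !PhiE le_measure ?inE//.
by apply: subset_itvl; rewrite bnd_simp.
Qed.

Lemma continuous_Phi : continuous Phi.
Proof.
move=> x; apply/differentiable_continuous/derivable1_diffP.
by have := is_derive_Phi x.
Qed.

Lemma measurable_Phi : measurable_fun setT Phi.
Proof. by apply: continuous_measurable_fun; exact: continuous_Phi. Qed.

Lemma PhiN (x : R) : Phi (- x) = 1 - Phi x.
Proof.
apply: EFin_inj; rewrite EFinB !PhiE.
rewrite /std_normal_cdf {1}/normal_prob.
rewrite -[X in - X]opprK.
rewrite ge0_integration_by_substitutionNy; last 2 first.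
- exact/continuous_subspaceT/continuous_normal_pdf.
- by move=> ? ?; exact: normal_pdf_ge0.
rewrite opprK.
under eq_integral do rewrite /= std_normal_pdfN.
rewrite -integral_itv_obnd_cbnd; last first.
  by apply/measurable_EFinP; apply: measurable_funTS; exact: measurable_normal_pdf.
rewrite -[LHS]/(normal_prob 0 1 `]x, +oo[).
rewrite -(probability_setT (@normal_prob R 0 1)).
rewrite -setCitvl.
by rewrite probability_setC// probability_setT.
Qed.

Lemma Phi_cvgNy : Phi x @[x --> -oo] --> (0 : R).
Proof.
(* Under the normal law the identity is a random variable whose distribution function is [Phi]. *)
pose id_isM := isMeasurableFun.Build _ _ (measurableTypeR R) R idfun (@measurable_id _ _ setT).
pose idR : {RV (@normal_prob R 0 1) >-> R} := HB.pack (idfun : measurableTypeR R -> R) id_isM.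
exact: fine_cvg (cvg_cdfNy0 idR).
Qed.

Lemma std_normal_pdf_cvgNy : phi x @[x --> -oo] --> (0 : R).
Proof.
apply/cvgNy_compNP.
rewrite (_ : (fun _ => _) = fun x => normal_peak 1 * gauss_fun (x / Num.sqrt 2)); last first.
  apply/funext => x/=; rewrite std_normal_pdfN std_normal_pdfE /gauss_fun.
  by rewrite exprMn exprVn sqr_sqrtr// mulNr.
suff /(cvgM (cvg_cst (normal_peak 1))) : gauss_fun (x / Num.sqrt 2) @[x --> +oo] --> (0 : R).
  by rewrite mulr0.
apply: (cvg_comp _ _ _ (@cvg_gauss_fun R)).
have s20 : 0 < (Num.sqrt (2 : R))^-1 by rewrite invr_gt0 sqrtr_gt0.
exact: gt0_cvgMly s20 cvg_id.
Qed.

(** By the mean value theorem [F y <= F x] for [y <= x]; let [y] tend to [-oo]. Both Mills ratio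
    bounds follow by taking for [F] the difference of their two sides. *)
Lemma derive_ge0_cvgNy0 (F f : R -> R) (b : R) :
  (forall x, x < b -> is_derive x 1 F (f x)) -> (forall x, x < b -> 0 <= f x) ->
  F x @[x --> -oo] --> (0 : R) -> forall x, x < b -> 0 <= F x.
Proof.
move=> dF f0 F0 x xb.
apply: (cvgr_to_le F0).
near=> y.
have yx : y <= x by [].
have d z : z \in `]y, x[ -> is_derive z 1 F (f z).
  by rewrite in_itv/= => /andP[_ zx]; exact/dF/(lt_trans zx).
have [|c] := MVT_segment yx d.
  apply: derivable_within_continuous => z; rewrite in_itv/= => /andP[_ zx].
  by have := dF z (le_lt_trans zx xb).
rewrite in_itv/= => /andP[_ cx] /eqP; rewrite subr_eq => /eqP ->.
rewrite lerDr mulr_ge0 ?subr_ge0// f0//.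
exact: le_lt_trans xb.
Unshelve. all: end_near. Qed.

Lemma is_derive_PhiB_Mills (x : R) : x < 0 ->
  is_derive x 1 (fun y => - phi y / y - Phi y) (phi x / x ^+ 2).
Proof.
move=> x0; have xn0 : x != 0 by rewrite lt_eqF.
have ? := is_derive_std_normal_pdf x; have ? := is_derive_Phi x.
have ? := is_deriveV xn0 (is_derive_id x (1 : R)).
by apply: is_derive_eq; rewrite /GRing.scale/=; field.
Qed.

Lemma Mills_upper (x : R) : x < 0 -> Phi x <= - phi x / x.
Proof.
move=> x0; rewrite -subr_ge0.
apply: (derive_ge0_cvgNy0 is_derive_PhiB_Mills _ _ x0).
  by move=> y y0; rewrite divr_ge0 ?sqr_ge0// normal_pdf_ge0.
suff /cvgB/(_ Phi_cvgNy) : - phi x / x @[x --> -oo] --> (0 : R) by rewrite subr0.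
apply: (@squeeze_cvgr _ _ _ _ (cst 0) phi); last 2 first.
- exact: cvg_cst.
- exact: std_normal_pdf_cvgNy.
near=> y.
have y1 : y <= -1 by [].
have y0 : 0 < - y by lra.
have -> : - phi y / y = phi y / - y by rewrite invrN mulrN mulNr.
have /= -> : 0 <= phi y / - y by rewrite divr_ge0 ?normal_pdf_ge0// ltW.
rewrite ler_pdivrMr// ler_peMr ?normal_pdf_ge0//.
by rewrite lerNr.
Unshelve. all: end_near. Qed.

Lemma sqr1D_gt0 (x : R) : 0 < 1 + x ^+ 2.
Proof. by rewrite ltr_pwDl ?sqr_ge0. Qed.

Lemma is_derive_PhiD_Mills (x : R) :
  is_derive x 1 (fun y => Phi y + y * phi y / (1 + y ^+ 2))
    (2 * phi x / (1 + x ^+ 2) ^+ 2).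
Proof.
have xn0 : 1 + x ^+ 2 != 0 by rewrite gt_eqF ?sqr1D_gt0.
have ? := is_derive_std_normal_pdf x; have ? := is_derive_Phi x.
have dx : is_derive x 1 (fun y => 1 + y ^+ 2 : R) (2 * x).
  by apply: is_derive_eq; rewrite /GRing.scale/=; ring.
have ? := @is_deriveV _ (fun y => 1 + y ^+ 2) _ _ _ xn0 dx.
by apply: is_derive_eq; rewrite /GRing.scale/=; field.
Qed.

(** The left-hand side is the numerator of the derivative of [iPhi / phi] below. *)
Lemma Mills_lower (x : R) : 0 <= (1 + x ^+ 2) * Phi x + x * phi x.
Proof.
have x2 := sqr1D_gt0 x.
suff : 0 <= Phi x + x * phi x / (1 + x ^+ 2).
  rewrite -(pmulr_rge0 _ x2) mulrDr [_ * (_ / _)]mulrC divfK//.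
  by rewrite gt_eqF.
apply: (@derive_ge0_cvgNy0 _ _ (x + 1) (fun y _ => is_derive_PhiD_Mills y)); last 2 first.
- have : Phi x - phi x @[x --> -oo] --> (0 - 0 : R).
    by apply: cvgB; [exact: Phi_cvgNy|exact: std_normal_pdf_cvgNy].
  rewrite subr0 => PhiB.
  apply: (squeeze_cvgr _ PhiB Phi_cvgNy).
  near=> y.
  have y0 : y <= 0 by [].
  have y2 := sqr1D_gt0 y; have p0 := std_normal_pdf_gt0 y.
  apply/andP; split.
    by rewrite lerD2l ler_pdivlMr// mulNr mulrC -mulNr ler_pM2r//; nra.
  by rewrite gerDl pmulr_lle0 ?invr_gt0// pmulr_lle0.
- by rewrite ltrDl.
- by move=> y _; rewrite divr_ge0 ?sqr_ge0// mulr_ge0 ?normal_pdf_ge0.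
Unshelve. all: end_near. Qed.

(** [iPhi x] is the integral of [Phi] over [`]-oo, x]]. *)
Definition iPhi (x : R) : R := phi x + x * Phi x.

Lemma is_derive_iPhi (x : R) : is_derive x 1 iPhi (Phi x).
Proof.
have ? := is_derive_std_normal_pdf x; have ? := is_derive_Phi x.
by apply: is_derive_eq; rewrite /GRing.scale/=; ring.
Qed.

Lemma iPhiN (x : R) : iPhi (- x) = iPhi x - x.
Proof. by rewrite /iPhi std_normal_pdfN PhiN; ring. Qed.

Lemma iPhi_ge0 (x : R) : 0 <= iPhi x.
Proof.
have [x0|x0] := ltP x 0; last first.
  by rewrite addr_ge0 ?normal_pdf_ge0// mulr_ge0// Phi_ge0.
have := Mills_upper x0; rewrite ler_ndivlMr// /iPhi; lra.
Qed.

(** This is [Mills_lower] multiplied by [- x]. The factor [1 + x ^+ 2] is what later absorbs the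
    linear growth of [iPhi (- x)]. *)
Lemma iPhi_le (x : R) : x <= 0 -> (1 + x ^+ 2) * iPhi x <= phi x.
Proof.
move=> x0; have := Mills_lower x; rewrite /iPhi => m.
have : 0 <= - x * ((1 + x ^+ 2) * Phi x + x * phi x) by rewrite mulr_ge0// oppr_ge0.
lra.
Qed.

Lemma iPhi_cvgNy : iPhi x @[x --> -oo] --> (0 : R).
Proof.
apply: (squeeze_cvgr _ (cvg_cst 0) std_normal_pdf_cvgNy).
near=> y; rewrite /= iPhi_ge0//=.
have y0 : y <= 0 by [].
by rewrite gerDl mulr_le0_ge0// Phi_ge0.
Unshelve. all: end_near. Qed.

(** The numerator of the derivative is exactly the quantity of [Mills_lower]. This monotonicity
    decides the sign of the increments of the kernel of [stein_g]. *)
Lemma iPhi_div_nd (x y : R) : x <= y -> iPhi x / phi x <= iPhi y / phi y.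
Proof.
move=> xy.
have d (z : R) : is_derive z 1 (fun z => iPhi z / phi z)
    (((1 + z ^+ 2) * Phi z + z * phi z) / phi z).
  have zn0 : phi z != 0 by rewrite gt_eqF// std_normal_pdf_gt0.
  have dz := is_derive_std_normal_pdf z; have ? := is_derive_iPhi z.
  have ? := @is_deriveV _ phi _ _ _ zn0 dz.
  by apply: is_derive_eq; rewrite /GRing.scale/= /iPhi; field.
have [|c _ /eqP] := MVT_segment xy (fun z _ => d z).
  by apply: derivable_within_continuous => z _; have := d z.
rewrite subr_eq => /eqP ->.
by rewrite lerDr mulr_ge0 ?subr_ge0// divr_ge0 ?normal_pdf_ge0 ?Mills_lower.
Qed.

Lemma integral_cPhi (x : R) :
  (\int[mu]_(t in `[x, +oo[) (1 - Phi t)%:E = (iPhi (- x))%:E)%E.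
Proof.
have d (t : R) : is_derive t 1 (fun t => - iPhi (- t)) (1 - Phi t).
  have ? := is_derive_iPhi (- t).
  by apply: is_derive_eq; rewrite /GRing.scale/= PhiN; ring.
rewrite (@ge0_continuous_FTC2y _ _ (fun t => - iPhi (- t)) _ 0).
- by rewrite sub0e -EFinN opprK.
- by move=> t _; rewrite subr_ge0 Phi_le1.
- apply: continuous_subspaceT => t.
  by apply: cvgB; [exact: cvg_cst|exact: continuous_Phi].
- by have := cvgN iPhi_cvgNy; rewrite oppr0 cvgNy_compNP; apply.
- by move=> t _; have := d t.
- apply: cvg_at_right_filter.
  suff : {for x, continuous (fun t : R => - iPhi (- t))} by [].
  by apply/differentiable_continuous/derivable1_diffP; have := d x.
- by move=> t _; rewrite derive1E; exact: (@derive_val _ _ _ _ _ _ _ (d t)).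
Qed.

Lemma integral_Phi (x : R) :
  (\int[mu]_(t in `]-oo, x]) (Phi t)%:E = (iPhi x)%:E)%E.
Proof.
rewrite -[X in `]-oo, X]](opprK x) ge0_integration_by_substitutionNy.
- under eq_integral do rewrite /= PhiN.
  by rewrite integral_cPhi opprK.
- exact/continuous_subspaceT/continuous_Phi.
- by move=> ? ?; exact: Phi_ge0.
Qed.

End std_normal.

(** * The solution of the Stein equation *)

Section stein_solution.
Context {R : realType}.
Local Notation mu := (@lebesgue_measure R).
Local Notation phi := (@normal_pdf R 0 1).

(** The integrand [Phi t - (x <= t)] of [H] is [below x t - above x t]. Both pieces are nonnegative,
    with integrals [iPhi x] and [iPhi (- x)], so that estimates on the Stein solution become
    estimates on [iPhi]. *)
Definition below (x t : R) : R := Phi t * (t < x)%R%:R.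
Definition above (x t : R) : R := (1 - Phi t) * (x <= t)%R%:R.

Lemma indic_itvNyo (x t : R) : (t < x)%R%:R = \1_`]-oo, x[ t :> R.
Proof. by rewrite indicE mem_setE in_itv. Qed.

Lemma indic_itvcy (x t : R) : (x <= t)%R%:R = \1_`[x, +oo[ t :> R.
Proof. by rewrite indicE mem_setE in_itv/= andbT. Qed.

Lemma measurable_below (x : R) : measurable_fun setT (below x).
Proof.
apply: measurable_funM; first exact: measurable_Phi.
by under eq_fun do rewrite indic_itvNyo; exact: measurable_indic.
Qed.

Lemma measurable_above (x : R) : measurable_fun setT (above x).
Proof.
apply: measurable_funM.
  by apply: measurable_funB => //; exact: measurable_Phi.
by under eq_fun do rewrite indic_itvcy; exact: measurable_indic.
Qed.

Lemma below_ge0 (x t : R) : 0 <= below x t.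
Proof. by rewrite mulr_ge0// Phi_ge0. Qed.

Lemma above_ge0 (x t : R) : 0 <= above x t.
Proof. by rewrite mulr_ge0// subr_ge0 Phi_le1. Qed.

Lemma integral_below (x : R) : (\int[mu]_t (below x t)%:E = (iPhi x)%:E)%E.
Proof.
rewrite -integral_Phi -integral_itv_bndo_bndc; last first.
  by apply/measurable_EFinP; apply: measurable_funTS; exact: measurable_Phi.
rewrite [RHS]integral_mkcond; apply: eq_integral => t _.
rewrite patchE /below mem_setE in_itv/=.
by case: ifPn => _; rewrite ?mulr1 ?mulr0.
Qed.

Lemma integral_above (x : R) : (\int[mu]_t (above x t)%:E = (iPhi (- x))%:E)%E.
Proof.
rewrite -integral_cPhi.
rewrite [RHS]integral_mkcond; apply: eq_integral => t _.
rewrite patchE /above mem_setE in_itv/= andbT.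
by case: ifPn => _; rewrite ?mulr1 ?mulr0.
Qed.

Lemma integrable_below (x : R) : mu.-integrable setT (EFin \o below x).
Proof.
apply/integrableP; split; first by apply/measurable_EFinP; exact: measurable_below.
under eq_integral do rewrite /= ger0_norm ?below_ge0//.
by rewrite integral_below ltry.
Qed.

Lemma integrable_above (x : R) : mu.-integrable setT (EFin \o above x).
Proof.
apply/integrableP; split; first by apply/measurable_EFinP; exact: measurable_above.
under eq_integral do rewrite /= ger0_norm ?above_ge0//.
by rewrite integral_above ltry.
Qed.

Lemma integral_itv (x y : R) : x <= y ->
  (\int[mu]_t (\1_`[x, y[ t)%:E = (y - x)%:E)%E.
Proof.
move=> xy; rewrite integral_indic// setIT.
rewrite [LHS](lebesgue_measure_itv `[x, y[)/= lte_fin.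
case: ltP => [_|yx]; first by rewrite EFinB.
by have -> : x = y; [apply/le_anti; rewrite xy yx|rewrite subrr].
Qed.

Lemma integrable_itv (x y : R) : x <= y ->
  mu.-integrable setT (EFin \o \1_`[x, y[).
Proof.
move=> xy; apply/integrableP; split.
  by apply/measurable_EFinP; exact: measurable_indic.
under eq_integral do rewrite /= ger0_norm//.
by rewrite integral_itv// ltry.
Qed.

Lemma Rintegral_itv (x y : R) : x <= y -> \int[mu]_t \1_`[x, y[ t = y - x.
Proof. by move=> xy; rewrite /Rintegral integral_itv. Qed.

Lemma integrable_mul_bounded (s b : R -> R) (M : R) :
  measurable_fun setT s -> (forall t, `|s t| <= M) ->
  mu.-integrable setT (EFin \o b) ->
  mu.-integrable setT (EFin \o (fun t => s t * b t)).
Proof.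
move=> ms sM ib; apply: le_integrable (integrableZl measurableT M ib) => //.
  apply/measurable_EFinP/measurable_funM => //.
  by apply/measurable_EFinP; case/integrableP : ib.
move=> t _ /=; rewrite lee_fin !normrM ler_wpM2r//.
by rewrite (le_trans (sM t))// ler_norm.
Qed.

Variable s : R -> R.
Hypothesis ms : measurable_fun setT s.
Hypothesis s_le1 : forall t, `|s t| <= 1.

Lemma integrable_bounded_mul (b : R -> R) : mu.-integrable setT (EFin \o b) ->
  mu.-integrable setT (EFin \o (fun t => s t * b t)).
Proof.
exact: integrable_mul_bounded.
Qed.

Local Notation J b := (\int[mu]_t (s t * b t)).

Lemma norm_Rintegral_mul_le (b c : R -> R) :
  mu.-integrable setT (EFin \o b) -> mu.-integrable setT (EFin \o c) ->
  (forall t, `|b t| <= c t) -> `|J b| <= \int[mu]_t c t.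
Proof.
move=> ib ic bc; have isb := integrable_bounded_mul ib.
apply: (le_trans (le_normr_Rintegral _ isb)) => //.
apply: le_Rintegral => //.
  have /= := integrable_norm isb; apply: eq_integrable => //.
move=> t _; rewrite normrM (le_trans _ (bc t))// ler_piMl//.
Qed.

Lemma Rintegral_mul_lin (a b : R) (p q : R -> R) :
  mu.-integrable setT (EFin \o p) -> mu.-integrable setT (EFin \o q) ->
  J (fun t => a * p t + b * q t) = a * J p + b * J q.
Proof.
move=> ip iq.
have isp := integrable_bounded_mul ip; have isq := integrable_bounded_mul iq.
rewrite -!RintegralZl//.
rewrite -RintegralD//; [|exact: (integrableZl _ a isp)|exact: (integrableZl _ b isq)].
by apply: eq_Rintegral => t _; ring.
Qed.

(** [stein_U] and [stein_V] split the integral against the kernel [q x] of the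
    Stein solution at [t = x]; [stein_g] is the derivative of [stein_f]. *)
Definition stein_U (x : R) : R := J (below x).
Definition stein_V (x : R) : R := J (above x).
Definition stein_H (x : R) : R := stein_U x - stein_V x.
Definition stein_f (x : R) : R :=
  - ((1 - Phi x) * stein_U x + Phi x * stein_V x) / phi x.
Definition stein_g (x : R) : R := x * stein_f x + stein_H x.

Lemma stein_U_le (x : R) : `|stein_U x| <= iPhi x.
Proof.
apply: le_trans (norm_Rintegral_mul_le (integrable_below x) (integrable_below x) _) _.
  by move=> t; rewrite ger0_norm ?below_ge0.
by rewrite /Rintegral integral_below.
Qed.

Lemma stein_V_le (x : R) : `|stein_V x| <= iPhi (- x).
Proof.
apply: le_trans (norm_Rintegral_mul_le (integrable_above x) (integrable_above x) _) _.
  by move=> t; rewrite ger0_norm ?above_ge0.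
by rewrite /Rintegral integral_above.
Qed.

(** Inserting the bounds on [stein_U] and [stein_V] turns the numerator into exactly [phi x]. The
    extreme case is [s = 1], where [H x = x] and the solution is the constant [-1]. *)
Lemma stein_f_le1 (x : R) : `|stein_f x| <= 1.
Proof.
have p0 := std_normal_pdf_gt0 x.
rewrite normrM normrN normfV (gtr0_norm p0) ler_pdivrMr// mul1r.
apply: (le_trans (ler_normD _ _)).
rewrite !normrM (ger0_norm (Phi_ge0 x)) ger0_norm ?subr_ge0 ?Phi_le1//.
have -> : phi x = (1 - Phi x) * iPhi x + Phi x * iPhi (- x).
  by rewrite iPhiN /iPhi; ring.
by rewrite lerD// ler_wpM2l ?Phi_ge0 ?subr_ge0 ?Phi_le1 ?stein_U_le ?stein_V_le.
Qed.

Lemma stein_gE (x : R) :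
  stein_g x = iPhi (- x) / phi x * stein_U x - iPhi x / phi x * stein_V x.
Proof.
have p0 : phi x != 0 by rewrite gt_eqF// std_normal_pdf_gt0.
by rewrite /stein_g /stein_f /stein_H iPhiN /iPhi; field.
Qed.

(** Only finiteness matters here: the bound makes [stein_g] bounded and hence integrable, and its
    value does not reach the theorem. By symmetry take [x <= 0], where [iPhi_le] bounds both
    [iPhi x] and [- x * iPhi x] by [phi x]. *)
Lemma iPhi_mul_le (x : R) : iPhi x * iPhi (- x) / phi x <= normal_peak 1 + 1.
Proof.
wlog x0 : x / x <= 0 => [hw|].
  have [|/ltW x0] := leP x 0; first exact: hw.
  have := hw (- x); rewrite opprK oppr_le0 std_normal_pdfN mulrC.
  by rewrite (mulrC (iPhi x)) mulrC; apply.
have p0 := std_normal_pdf_gt0 x; rewrite ler_pdivrMr//.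
have := iPhi_le x0; have := iPhi_ge0 x.
have := @normal_pdf_ub R 0 1 x (oner_neq0 _).
rewrite iPhiN.
move: (iPhi x) (phi x) p0 (normal_peak _) => a p p0 K pK a0 ap.
have ap' : a <= p by nra.
have axp : - x * a <= p.
  suff : 0 <= (1 + x ^+ 2 + x) * a by nra.
  by rewrite mulr_ge0//; nra.
nra.
Qed.

Lemma stein_g_bounded (x : R) : `|stein_g x| <= 2 * (normal_peak 1 + 1).
Proof.
rewrite stein_gE (le_trans (ler_normB _ _))//.
rewrite !normrM normfV !(ger0_norm (iPhi_ge0 _)) (ger0_norm (normal_pdf_ge0 _ _ _)).
have p0 : 0 <= (phi x)^-1 by rewrite invr_ge0 normal_pdf_ge0.
rewrite [leRHS]mulr_natl mulr2n.
apply: lerD.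
  apply: le_trans (iPhi_mul_le x).
  rewrite -[leRHS]mulrA [leLHS]mulrC ler_wpM2r ?stein_U_le//.
  by rewrite mulr_ge0// iPhi_ge0.
apply: le_trans (iPhi_mul_le x).
by rewrite [leRHS]mulrAC ler_wpM2l ?stein_V_le// mulr_ge0// iPhi_ge0.
Qed.

Definition stein_k (x t : R) : R :=
  iPhi (- x) / phi x * below x t + - (iPhi x / phi x) * above x t.

Lemma integrable_lin (a b : R) (p q : R -> R) :
  mu.-integrable setT (EFin \o p) -> mu.-integrable setT (EFin \o q) ->
  mu.-integrable setT (EFin \o (fun t => a * p t + b * q t)).
Proof.
move=> ip iq.
exact: integrableD (integrableZl _ a ip) (integrableZl _ b iq).
Qed.

Lemma integrable_stein_k (x : R) : mu.-integrable setT (EFin \o stein_k x).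
Proof. exact: integrable_lin (integrable_below x) (integrable_above x). Qed.

Lemma stein_g_k (x : R) : stein_g x = J (stein_k x).
Proof.
rewrite stein_gE Rintegral_mul_lin ?mulNr//; first exact: integrable_below.
exact: integrable_above.
Qed.

(** This is the case [s = 1], where the Stein solution is constant and its derivative vanishes. *)
Lemma Rintegral_stein_k (x : R) : \int[mu]_t stein_k x t = 0.
Proof.
rewrite RintegralD ?RintegralZl//; last 4 first.
- exact: integrable_above.
- exact: integrable_below.
- exact: (integrableZl _ _ (integrable_below x)).
- exact: (integrableZl _ _ (integrable_above x)).
by rewrite /Rintegral integral_above integral_below/=; ring.
Qed.

(** Between [x] and [y] the increment of the kernel is at most [1], because
    [iPhi / phi] is nondecreasing and the extreme case [x = y = t] gives exactly
    [1]; elsewhere the increment is nonpositive. As the kernel has integral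
    [0], adding [1] to [s] is harmless and replaces a bound on the total
    variation by a one-sided bound. *)
Lemma stein_k_incr (x y t : R) : x <= y ->
  (1 + s t) * (stein_k y t - stein_k x t) <= 2 * \1_`[x, y[ t.
Proof.
move=> xy; have := s_le1 t; rewrite ler_norml => /andP[sN1 s1].
have -> : \1_`[x, y[ t = ((x <= t) && (t < y))%R%:R :> R.
  by rewrite indicE mem_setE in_itv.
have Phi0 := Phi_ge0 t; have Phi1 := Phi_le1 t.
rewrite /stein_k /below /above.
have [xt|tx] := leP x t; have [ty|yt] := ltP t y => //=.
- rewrite !mulr0 !mulr1 add0r addr0 mulNr opprK.
  suff : iPhi (- y) / phi y * Phi t + iPhi x / phi x * (1 - Phi t) <= 1 by nra.
  have h1 : iPhi (- y) / phi y <= iPhi (- t) / phi t.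
    rewrite -(std_normal_pdfN y) -(std_normal_pdfN t).
    by apply: iPhi_div_nd; rewrite lerN2 ltW.
  have h2 := iPhi_div_nd xt.
  have e1 : iPhi (- t) / phi t * Phi t + iPhi t / phi t * (1 - Phi t) = 1.
    by rewrite iPhiN /iPhi; field; rewrite gt_eqF// std_normal_pdf_gt0.
  rewrite -[leRHS]e1.
  by apply: lerD; rewrite ler_wpM2r// ?subr_ge0.
- rewrite !mulr0 !mulr1 !add0r.
  have h := iPhi_div_nd xy.
  rewrite mulr_ge0_le0//; first lra.
  by rewrite -mulrBl mulr_le0_ge0 ?subr_ge0// subr_le0 lerN2.
- rewrite !mulr0 !mulr1 !addr0.
  have h : iPhi (- y) / phi y <= iPhi (- x) / phi x.
    rewrite -(std_normal_pdfN y) -(std_normal_pdfN x).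
    by apply: iPhi_div_nd; rewrite lerN2.
  rewrite mulr_ge0_le0//; first lra.
  by rewrite -mulrBl mulr_le0_ge0// subr_le0.
- by have := lt_le_trans tx (le_trans xy yt); rewrite ltxx.
Qed.

Lemma stein_g_incr (x y : R) : x <= y -> stein_g y - stein_g x <= 2 * (y - x).
Proof.
move=> xy; have ik := integrable_stein_k.
have isk z := integrable_bounded_mul (ik z).
have iB := integrableB measurableT (ik y) (ik x).
have isB := integrableB measurableT (isk y) (isk x).
have -> : stein_g y - stein_g x = \int[mu]_t
    ((s t * stein_k y t - s t * stein_k x t) + (stein_k y t - stein_k x t)).
  rewrite RintegralD// !RintegralB// !Rintegral_stein_k subrr addr0.
  by rewrite !stein_g_k.
rewrite -Rintegral_itv// -RintegralZl//; last exact: integrable_itv.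
apply: le_Rintegral => //.
- exact: (integrableD _ isB iB).
- exact: (integrableZl _ 2 (integrable_itv xy)).
- by move=> t _; have := stein_k_incr t xy; lra.
Qed.

(** [stein_U] and [stein_V] need not be differentiable, [s] being only
    measurable; their combination in [stein_f] is, with a quadratic remainder. *)
Lemma is_derive_remainder (F p : R -> R) (x dp c : R) :
  is_derive x 1 p dp ->
  (forall y, `|F y - F x - c * (p y - p x)| <= `|y - x| * `|p y - p x|) ->
  is_derive x 1 F (c * dp).
Proof.
move=> dpx Fle.
suff h : h^-1 *: ((F \o shift x) (h *: 1) - F x) @[h --> 0^'] --> c * dp.
  by apply: DeriveDef; [exact: cvgP h|exact: cvg_lim h].
pose q h := h^-1 *: ((p \o shift x) (h *: 1) - p x).
have qdp : q h @[h --> 0^'] --> dp.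
  by rewrite -(@derive_val _ _ _ _ _ _ _ dpx); apply: ex_derive.
pose e h := h^-1 *: ((F \o shift x) (h *: 1) - F x) - c * q h.
suff e0 : e h @[h --> 0^'] --> (0 : R).
  rewrite (_ : (fun h => _) = (fun h => e h + c * q h)); last first.
    by apply/funext => h; rewrite /e subrK.
  rewrite -[c * dp]add0r; apply: cvgD => //.
  by apply: cvgM => //; exact: cvg_cst.
apply/norm_cvg0P.
have hq0 : `|h| * `|q h| @[h --> 0^'] --> (0 : R).
  have hid : h @[h --> (0 : R)^'] --> (0 : R) by exact: cvg_within.
  by have := cvgM (cvg_norm hid) (cvg_norm qdp); rewrite normr0 mul0r; apply.
apply: (squeeze_cvgr _ (cvg_cst 0) hq0); near=> h.
rewrite normr_ge0/=.
have h0 : h != 0 by near: h; exact: nbhs_dnbhs_neq.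
have := Fle (h + x); rewrite addrK /e /q /= /GRing.scale/= mulr1.
move: (F (h + x) - F x) (p (h + x) - p x) => DF Dp hle.
have -> : h^-1 * DF - c * (h^-1 * Dp) = h^-1 * (DF - c * Dp) by ring.
rewrite !normrM normfV [leRHS]mulrA divff ?normr_eq0// mul1r.
by rewrite ler_pdivrMl ?normr_gt0.
Unshelve. all: end_near. Qed.

Lemma is_derive_stein_f (x : R) : is_derive x 1 stein_f (stein_g x).
Proof.
pose G x := (1 - Phi x) * stein_U x + Phi x * stein_V x.
(* Formally [stein_U] has derivative [s * Phi] and [stein_V] has derivative [- s * (1 - Phi)]; their
   contributions to [G] cancel, and what remains is [phi * (stein_V - stein_U)]. *)
have dG : is_derive x 1 G (- stein_H x * phi x).
  apply: is_derive_remainder (is_derive_Phi x) _ => y.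
  (* The first-order remainder is the integral of [s * b]. The function [b] vanishes unless [t] lies
     between [x] and [y], where its absolute value is [|Phi y - Phi t|], at most
     [|Phi y - Phi x|]. *)
  pose b t := (1 - Phi y) * (below y t - below x t) + Phi y * (above y t - above x t).
  have iu := integrableB measurableT (integrable_below y) (integrable_below x).
  have iv := integrableB measurableT (integrable_above y) (integrable_above x).
  have -> : G y - G x - - stein_H x * (Phi y - Phi x) = J b.
    have isu z := integrable_bounded_mul (integrable_below z).
    have isv z := integrable_bounded_mul (integrable_above z).
    have BU : J (fun t => below y t - below x t) = stein_U y - stein_U x.
      by rewrite -RintegralB//; apply: eq_Rintegral => t _; rewrite mulrBr.
    have BV : J (fun t => above y t - above x t) = stein_V y - stein_V x.
      by rewrite -RintegralB//; apply: eq_Rintegral => t _; rewrite mulrBr.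
    rewrite Rintegral_mul_lin// BU BV /G /stein_H; ring.
  have ib : mu.-integrable setT (EFin \o b) by exact: integrable_lin.
  have [xy|/ltW yx] := leP x y.
    have yx0 : 0 <= y - x by rewrite subr_ge0.
    rewrite (ger0_norm yx0) [leRHS]mulrC -(Rintegral_itv xy).
    rewrite -RintegralZl//; last exact: integrable_itv.
    apply: norm_Rintegral_mul_le => //.
      exact: (integrableZl _ _ (integrable_itv xy)).
    move=> t; rewrite /b /below /above indicE mem_setE in_itv/=.
    have [xt|tx] := leP x t; have [ty|yt] := ltP t y => /=.
    - rewrite !mulr0 !mulr1.
      have -> : (1 - Phi y) * (Phi t - 0) + Phi y * (0 - (1 - Phi t)) =
        - (Phi y - Phi t) by ring.
      by rewrite normrN !ger0_norm ?subr_ge0 ?lerB ?Phi_nd// ltW.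
    - by rewrite !mulr0 !mulr1 !subrr !mulr0 addr0 normr0.
    - by rewrite !mulr0 !mulr1 !subrr !mulr0 addr0 normr0.
    - by have := lt_le_trans tx (le_trans xy yt); rewrite ltxx.
  have xy0 : 0 <= x - y by rewrite subr_ge0.
  rewrite (distrC y x) (ger0_norm xy0) [leRHS]mulrC -(Rintegral_itv yx).
  rewrite -RintegralZl//; last exact: integrable_itv.
  apply: norm_Rintegral_mul_le => //.
    exact: (integrableZl _ _ (integrable_itv yx)).
  move=> t; rewrite /b /below /above indicE mem_setE in_itv/=.
  have [xt|tx] := leP x t; have [ty|yt] := ltP t y => /=.
  - by have := lt_le_trans ty (le_trans yx xt); rewrite ltxx.
  - by rewrite !mulr0 !mulr1 !subrr !mulr0 addr0 normr0.
  - by rewrite !mulr0 !mulr1 !subrr !mulr0 addr0 normr0.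
  - rewrite !mulr0 !mulr1.
    have -> : (1 - Phi y) * (0 - Phi t) + Phi y * (1 - Phi t - 0) =
      - (Phi t - Phi y) by ring.
    by rewrite normrN (distrC (Phi y)) !ger0_norm ?subr_ge0 ?lerB ?Phi_nd// ltW.
have p0 : phi x != 0 by rewrite gt_eqF// std_normal_pdf_gt0.
have dV := @is_deriveV _ phi _ _ _ p0 (is_derive_std_normal_pdf x).
have -> : stein_f = - G * (fun x => (phi x)^-1) by [].
apply: is_derive_eq; rewrite /GRing.scale/= /stein_g /stein_f -/(G x).
by rewrite (_ : (- G) x = - G x)//; field.
Qed.

End stein_solution.

Section stein_lipschitz.
Context {R : realType} (s : R -> R).
Local Notation mu := (@lebesgue_measure R).
Hypotheses (ms : measurable_fun setT s) (s_le1 : forall t, `|s t| <= 1).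

Lemma stein_gN (x : R) : stein_g (fun t => - s t) x = - stein_g s x.
Proof.
have msN : measurable_fun setT (fun t => - s t) by exact: measurableT_comp.
have N b : (forall x, mu.-integrable setT (EFin \o b x)) ->
  forall x, \int[mu]_t (- s t * b x t) = - \int[mu]_t (s t * b x t).
  move=> ib y; rewrite -[RHS]mulN1r -RintegralZl//; last exact: integrable_bounded_mul.
  by apply: eq_Rintegral => t _; rewrite mulN1r mulNr.
rewrite /stein_g /stein_f /stein_H /stein_U /stein_V !N; last 2 first.
- exact: integrable_above.
- exact: integrable_below.
ring.
Qed.

(** The one-sided bound [stein_g_incr] holds for [s] and for [- s], and [stein_g] is linear in
    [s]. *)
Lemma stein_g_lipschitz (x y : R) : `|stein_g s y - stein_g s x| <= 2 * `|y - x|.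
Proof.
wlog xy : x y / x <= y => [hw|].
  have [|/ltW yx] := leP x y; first exact: hw.
  by rewrite distrC (distrC y); exact: hw.
rewrite (ger0_norm (_ : 0 <= y - x)) ?subr_ge0// ler_norml stein_g_incr// andbT.
rewrite lerNl opprB.
have := @stein_g_incr R (fun t => - s t) _ _ x y xy.
rewrite !stein_gN opprK addrC; apply.
  exact: measurableT_comp.
by move=> t; rewrite normrN.
Qed.

End stein_lipschitz.

(** * Distribution functions and Fubini *)

Section steps.
Context {R : realType}.
Local Notation mu := (@lebesgue_measure R).

(** The steps are the distribution functions of point masses; integrating over the sample space,
    with Tonelli, carries this identity over to general distribution functions. *)
Lemma integral_dist_steps (x y : R) :
  (\int[mu]_t (`|(x <= t)%R%:R - (y <= t)%R%:R|%R)%:E = `|y - x|%:E)%E.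
Proof.
wlog xy : x y / x <= y => [hw|].
  have [|/ltW yx] := leP x y; first exact: hw.
  by rewrite distrC -hw//; apply: eq_integral => t _; rewrite distrC.
rewrite ger0_norm ?subr_ge0// -integral_itv//; apply: eq_integral => t _.
rewrite indicE mem_setE in_itv/=.
have [xt|tx] := leP x t; have [ty|yt] := ltP t y => //=.
- by rewrite subr0 normr1.
- by rewrite subrr normr0.
- by rewrite subrr normr0.
- by have := lt_le_trans tx (le_trans xy yt); rewrite ltxx.
Qed.

Lemma measurable_step d (T : measurableType d) (f g : T -> R) :
  measurable_fun setT f -> measurable_fun setT g ->
  measurable_fun setT (fun z => (f z <= g z)%R%:R : R).
Proof.
move=> mf mg.
rewrite (_ : (fun _ => _) = \1_[set z | f z <= g z]).
  apply: measurable_indic.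
  have := measurable_fun_ler mf mg => /(_ measurableT [set true]).
  by rewrite setTI; apply.
apply/funext => z; rewrite indicE.
by have [fg|fg] := boolP (f z <= g z); [rewrite mem_set|rewrite memNset//=; exact/negP].
Qed.

Lemma measurable_steps d (T : measurableType d) (X Y : T -> R) :
  measurable_fun setT X -> measurable_fun setT Y ->
  measurable_fun setT (fun z : T * measurableTypeR R =>
    (X z.1 <= z.2)%R%:R - (Y z.1 <= z.2)%R%:R : R).
Proof.
move=> mX mY.
apply: measurable_funB; apply: measurable_step => //.
- exact: measurableT_comp.
- exact: measurableT_comp.
Qed.

End steps.

Section cdf.
Context {R : realType} d (T : measurableType d) (P : probability T R).
Local Notation mu := (@lebesgue_measure R).

Lemma fin_num_cdf (X : {RV P >-> R}) (t : R) : cdf X t \is a fin_num.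
Proof. exact: fin_num_measure. Qed.

Lemma Rintegral_cst_probability (r : R) : \int[P]_w r = r.
Proof.
rewrite Rintegral_cst// [X in fine X](_ : _ = 1%E) ?mulr1//.
exact: probability_setT.
Qed.

Lemma integral_step (X : {RV P >-> R}) (A : set T) (t : R) : measurable A ->
  (\int[P]_w (\1_A w * (X w <= t)%R%:R)%:E = P (A `&` X @^-1` `]-oo, t]))%E.
Proof.
move=> mA.
have mX : measurable (X @^-1` `]-oo, t]) by exact: measurable_funPTI.
rewrite -[RHS]expectation_indic; last exact: measurableI.
rewrite unlock; apply: eq_integral => w _; rewrite indicI/=; congr (_ * _)%:E.
rewrite [RHS]indicE (_ : (w \in _) = (X w <= t)%R)//.
by apply/idP/idP; rewrite inE/= in_itv.
Qed.

Lemma cdf_integral (X : {RV P >-> R}) (t : R) :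
  cdf X t = (\int[P]_w ((X w <= t)%R%:R)%:E)%E.
Proof.
transitivity (P (setT `&` X @^-1` `]-oo, t])); first by rewrite setTI.
rewrite -integral_step//; apply: eq_integral => w _.
by rewrite indicT mul1r.
Qed.

Lemma integrable_bounded (f : T -> R) (M : R) : measurable_fun setT f ->
  (forall w, `|f w| <= M) -> P.-integrable setT (EFin \o f).
Proof.
move=> mf fM; apply: (@le_integrable _ _ _ _ _ _ _ (cst M%:E)) => //.
- exact/measurable_EFinP.
- by move=> w _ /=; rewrite lee_fin (le_trans (fM w))// ler_norm.
- exact: finite_measure_integrable_cst.
Qed.

Lemma integrable_step (X : {RV P >-> R}) (A : set T) (t : R) : measurable A ->
  P.-integrable setT (fun w => (\1_A w * (X w <= t)%R%:R : R)%:E).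
Proof.
move=> mA; apply: (@integrable_bounded _ 1).
  by apply: measurable_funM; [exact: measurable_indic|exact: measurable_step].
by move=> w; rewrite indicE; rewrite -natrM mulnb; case: (_ && _); rewrite ?normr0 ?normr1.
Qed.

Lemma measurable_measure_step (X : {RV P >-> R}) (A : set T) : measurable A ->
  measurable_fun setT (fun t : measurableTypeR R => P (A `&` X @^-1` `]-oo, t])).
Proof.
move=> mA; under eq_fun do rewrite -integral_step//.
pose F (z : T * measurableTypeR R) : \bar R :=
  (\1_A z.1 * (X z.1 <= z.2)%R%:R)%:E.
apply: (measurable_fun_fubini_tonelli_G F) => [|z]; last by rewrite lee_fin mulr_ge0.
apply/measurable_EFinP; apply: measurable_funM.
  exact: (measurableT_comp (measurable_indic _)).
by apply: measurable_step => //; exact: measurableT_comp.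
Qed.

(** The event [A] will be [J = i]: independence of the index then factors [P A] out of the left
    side, while the right sides add up over [i] to the expectation at the random index. The proof
    moves the absolute value inside the expectation and applies Tonelli. *)
Lemma dist_measure_le (X Y : {RV P >-> R}) (A : set T) : measurable A ->
  (\int[mu]_t `|P (A `&` X @^-1` `]-oo, t]) - P (A `&` Y @^-1` `]-oo, t])| <=
   \int[P]_w (\1_A w * `|X w - Y w|%R)%:E)%E.
Proof.
move=> mA.
pose F (z : T * measurableTypeR R) : \bar R :=
  (\1_A z.1 * `|(X z.1 <= z.2)%R%:R - (Y z.1 <= z.2)%R%:R|)%:E.
have mF : measurable_fun setT F.
  apply/measurable_EFinP; apply: measurable_funM.
    exact: (measurableT_comp (measurable_indic _)).
  by apply: measurableT_comp => //; exact: measurable_steps.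
have F0 z : (0 <= F z)%E by rewrite lee_fin mulr_ge0.
have mFt t : measurable_fun setT (fun w => F (w, t)).
  by apply: measurableT_comp => //; exact: measurable_pair2.
have -> : (\int[P]_w (\1_A w * `|X w - Y w|%R)%:E = \int[P]_w \int[mu]_t F (w, t))%E.
  apply: eq_integral => w _; rewrite /F/=.
  under eq_integral do rewrite EFinM.
  rewrite ge0_integralZl//=.
  - by rewrite integral_dist_steps distrC EFinM.
  - apply/measurable_EFinP; apply: measurableT_comp => //.
    by apply: measurable_funB; exact: measurable_step.
rewrite (fubini_tonelli F mF F0).
apply: ge0_le_integral => //.
- apply: measurableT_comp => //.
  by apply: emeasurable_funB; exact: measurable_measure_step.
- exact: measurable_fun_fubini_tonelli_G.
move=> t _.
rewrite -!integral_step//.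
rewrite -integralB_EFin//; [|exact: integrable_step..].
have mD := measurable_int P
  (integrableB measurableT (integrable_step X t mA) (integrable_step Y t mA)).
apply: (le_trans (le_abse_integral _ _ mD)) => //.
apply: ge0_le_integral => //; first exact: measurableT_comp.
move=> w _; rewrite lee_fin /F/= -mulrBr normrM.
by rewrite ger0_norm.
Qed.

(** For fixed [t] the difference of steps has a constant sign, decided by whether [0 <= t], so the
    absolute value passes through the expectation with equality. *)
Lemma dist_cdf0 (X : {RV P >-> R}) (t : R) :
  (`|(0 <= t)%R%:R%:E - cdf X t| =
   \int[P]_w (`|(0 <= t)%R%:R - (X w <= t)%R%:R|)%:E)%E.
Proof.
have istep : P.-integrable setT (fun w => ((X w <= t)%R%:R : R)%:E).
  have := integrable_step X t measurableT; apply: eq_integrable => // w _.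
  by rewrite indicT mul1r.
have [t0|t0] := leP 0 t => /=.
  rewrite gee0_abs; last by rewrite sube_ge0 ?fin_num_cdf// cdf_le1.
  rewrite cdf_integral -[X in (X%:E - _)%E]/(1 : R).
  have <- : (\int[P]_w (1 : R)%:E = 1)%E.
    by rewrite integral_cst// mul1e; exact: probability_setT.
  rewrite -integralB//; last exact: finite_measure_integrable_cst.
  apply: eq_integral => w _; case: (X w <= t)%R => /=.
    by rewrite subrr normr0 subee.
  by rewrite subr0 normr1 sube0.
rewrite sub0e abseN gee0_abs ?cdf_ge0// cdf_integral.
by apply: eq_integral => w _; rewrite sub0r normrN ger0_norm.
Qed.

Lemma integral_dist_cdf0 (X : {RV P >-> R}) :
  (\int[mu]_t `|(0 <= t)%R%:R%:E - cdf X t| = \int[P]_w (`|X w|%R)%:E)%E.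
Proof.
pose F (z : T * measurableTypeR R) : \bar R :=
  (`|(0 <= z.2)%R%:R - (X z.1 <= z.2)%R%:R|)%:E.
have mF : measurable_fun setT F.
  apply/measurable_EFinP; apply: measurableT_comp => //.
  exact: (@measurable_steps _ _ _ (cst 0)).
transitivity (\int[P]_w \int[mu]_t F (w, t))%E; last first.
  by apply: eq_integral => w _; rewrite /F/= integral_dist_steps subr0.
rewrite (fubini_tonelli F mF); last by move=> z; rewrite lee_fin.
by apply: eq_integral => t _; rewrite dist_cdf0.
Qed.

(** The step at [0] compensates [cdf X], which tends to [1] at [+oo] and so is not integrable. After
    compensation the inner integral of the absolute value is at most [M * |X w|], which justifies
    Fubini. *)
Lemma integral_cdf (X : {RV P >-> R}) (s : R -> R) (M : R) :
  measurable_fun setT s -> (forall t, `|s t| <= M) ->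
  P.-integrable setT (EFin \o X) ->
  (\int[P]_w (\int[mu]_t (s t * ((0 <= t)%R%:R - (X w <= t)%R%:R)))%R%:E =
   \int[mu]_t (s t * ((0 <= t)%R%:R - fine (cdf X t)))%:E)%E.
Proof.
move=> ms sM iX.
pose F (z : T * measurableTypeR R) : \bar R :=
  (s z.2 * ((0 <= z.2)%R%:R - (X z.1 <= z.2)%R%:R))%:E.
have mF : measurable_fun setT F.
  apply/measurable_EFinP; apply: measurable_funM; first exact: measurableT_comp.
  exact: (@measurable_steps _ _ _ (cst 0)).
have M0 : 0 <= M := le_trans (normr_ge0 _) (sM 0).
have mFw w : measurable_fun setT (fun t => F (w, t)).
  by apply: measurableT_comp => //; exact: measurable_pair1.
have mstep (w : T) : measurable_fun setT
    (fun t : measurableTypeR R => (`|(0 <= t)%R%:R - (X w <= t)%R%:R|%R)%:E : \bar R).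
  apply/measurable_EFinP; apply: measurableT_comp => //.
  by apply: measurable_funB; exact: measurable_step.
have mX : measurable_fun setT (fun w => (`|X w|%R)%:E).
  by apply/measurable_EFinP; exact: measurableT_comp.
have FM w : (\int[mu]_t `|F (w, t)| <= M%:E * (`|X w|%R)%:E)%E.
  rewrite -[X w]subr0 -integral_dist_steps -ge0_integralZl//.
  apply: ge0_le_integral => //.
  - exact: measurableT_comp.
  - exact: measurable_funeM.
  - by move=> t _; rewrite /F/= -EFinM lee_fin normrM ler_wpM2r.
have FMoo : (\int[P]_w (M%:E * (`|X w|%R)%:E) < +oo)%E.
  rewrite ge0_integralZl// lte_mul_pinfty//.
  by case/integrableP : iX.
have iF : (P \x mu)%E.-integrable setT F.
  apply/integrable12ltyP => //; apply: le_lt_trans FMoo.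
  apply: ge0_le_integral => //.
  - by move=> w _; exact: integral_ge0.
  - apply: (measurable_fun_fubini_tonelli_F (abse \o F)) => [|z].
      exact: measurableT_comp.
    exact: abse_ge0.
  - exact: measurable_funeM.
transitivity (\int[P]_w \int[mu]_t F (w, t))%E.
  apply: eq_integral => w _; rewrite /Rintegral fineK//.
  rewrite -[_ \is a fin_num]/(\int[mu]_t F (w, t) \is a fin_num)%E.
  rewrite fin_num_abs (le_lt_trans (le_abse_integral _ _ _))//.
  by rewrite (le_lt_trans (FM w))// ltry.
rewrite (Fubini iF); apply: eq_integral => t _; rewrite /F/=.
have istep : P.-integrable setT (fun w => ((X w <= t)%R%:R : R)%:E).
  have := integrable_step X t measurableT; apply: eq_integrable => // w _.
  by rewrite indicT mul1r.
have icst : P.-integrable setT (fun w => ((0 <= t)%R%:R : R)%:E).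
  exact: finite_measure_integrable_cst.
under eq_integral do rewrite EFinM.
rewrite integralZl//; last exact: (integrableB measurableT icst istep).
rewrite EFinM; congr (_ * _)%E; rewrite integralB_EFin//.
rewrite EFinB fineK ?fin_num_cdf// -cdf_integral; congr (_ - _)%E.
by rewrite integral_cst//= -[RHS]mule1; congr (_ * _)%E; exact: probability_setT.
Qed.

End cdf.

(** * Duality between Lipschitz functions and the L1 distance *)

Section primitive.
Context {R : realType}.
Local Notation mu := (@lebesgue_measure R).

Lemma is_derive_continuous (f df : R -> R) :
  (forall x : R, is_derive x 1 f (df x)) -> continuous f.
Proof.
move=> d x; apply/differentiable_continuous/derivable1_diffP.
by have := d x.
Qed.

Lemma is_derive_lipschitz (f df : R -> R) (L x y : R) :
  (forall x : R, is_derive x 1 f (df x)) -> (forall x, `|df x| <= L) ->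
  `|f y - f x| <= L * `|y - x|.
Proof.
move=> d dL; wlog xy : x y / x <= y => [hw|].
  have [|/ltW yx] := leP x y; first exact: hw.
  by rewrite distrC (distrC y); exact: hw.
have [|c _ ->] := MVT_segment xy (fun z _ => d z).
  exact/continuous_subspaceT/is_derive_continuous.
by rewrite normrM ler_wpM2r.
Qed.

Lemma lipschitz_continuous (f : R -> R) (L : R) :
  (forall x y, `|f y - f x| <= L * `|y - x|) -> continuous f.
Proof.
move=> fL x; apply/cvgrPdist_le => /= a a0.
have L1 : 0 < `|L| + 1 by rewrite ltr_wpDl.
near=> y.
rewrite (le_trans (fL _ _))// (@le_trans _ _ ((`|L| + 1) * `|x - y|))//.
  by rewrite ler_wpM2r// (le_trans (ler_norm _))// lerDl.
rewrite -ler_pdivlMl//.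
near: y; apply: cvgr_dist_le; first exact: cvg_id.
by rewrite mulr_gt0// invr_gt0.
Unshelve. all: end_near. Qed.

Lemma primitive_itv (f df : R -> R) (x y : R) : x <= y ->
  (forall t : R, is_derive t 1 f (df t)) -> continuous df ->
  \int[mu]_t (df t * \1_`[x, y[ t) = f y - f x.
Proof.
move=> xy d cont_df; have cf := is_derive_continuous d.
have mdf : measurable_fun setT df by exact: continuous_measurable_fun.
transitivity (fine (\int[mu]_(t in `[x, y]) (df t)%:E)).
  rewrite -integral_itv_bndo_bndc; last first.
    by apply/measurable_EFinP; exact: measurable_funTS.
  rewrite integral_mkcond /Rintegral; congr fine; apply: eq_integral => t _.
  by rewrite patchE indicE; case: ifPn => _; rewrite ?mulr1 ?mulr0.
move: xy; rewrite le_eqVlt => /predU1P[<-|xy].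
  by rewrite set_itv1 integral_set1 subrr.
rewrite (continuous_FTC2 xy (F := f)) -?EFinB//.
- exact: continuous_subspaceT.
- split.
  + by move=> t _; have := d t.
  + exact/cvg_at_right_filter/cf.
  + exact/cvg_at_left_filter/cf.
- by move=> t _; rewrite derive1E; exact: (@derive_val _ _ _ _ _ _ _ (d t)).
Qed.

Lemma primitive_steps (f df : R -> R) (L x : R) :
  (forall t : R, is_derive t 1 f (df t)) -> continuous df ->
  (forall t, `|df t| <= L) ->
  \int[mu]_t (df t * ((0 <= t)%R%:R - (x <= t)%R%:R)) = f x - f 0.
Proof.
move=> d cont_df dfL; have [x0|/ltW x0] := leP 0 x.
  rewrite -(primitive_itv x0 d cont_df); apply: eq_Rintegral => t _.
  rewrite indicE mem_setE in_itv/=; congr (_ * _).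
  have [t0|t0] := leP 0 t; have [tx|xt] := ltP t x => //=; rewrite ?subr0 ?subrr//.
  by have := lt_le_trans t0 (le_trans x0 xt); rewrite ltxx.
rewrite -[RHS]opprB -(primitive_itv x0 d cont_df) -mulN1r.
transitivity (\int[mu]_t (-1 * (df t * \1_`[x, 0[ t))).
  apply: eq_Rintegral => t _.
  rewrite indicE mem_setE in_itv/= mulrCA; congr (_ * _).
  have [t0|t0] := ltP t 0; have [tx|xt] := leP x t => //=; rewrite ?subrr ?sub0r ?mulr1 ?mulr0//.
  by have := lt_le_trans xt (le_trans x0 t0); rewrite ltxx.
rewrite RintegralZl//.
apply: le_integrable (integrableZl measurableT L (integrable_itv x0)) => //.
  apply/measurable_EFinP; apply: measurable_funM.
    exact: continuous_measurable_fun.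
  exact: measurable_indic.
move=> t _ /=; rewrite lee_fin !normrM ler_wpM2r//.
by rewrite (le_trans (dfL t))// ler_norm.
Qed.

End primitive.

Section duality.
Context {R : realType}.
Context d (T : measurableType d) (P : probability T R).
Local Notation mu := (@lebesgue_measure R).

Lemma integrable_cdf0 (X : {RV P >-> R}) : P.-integrable setT (EFin \o X) ->
  mu.-integrable setT (fun t => ((0 <= t)%R%:R - fine (cdf X t))%:E).
Proof.
move=> iX; apply/integrableP; split.
  apply/measurable_EFinP; apply: measurable_funB; first exact: measurable_step.
  apply/measurable_EFinP; apply: eq_measurable_fun (cdf_measurable X) => t _ /=.
  by rewrite fineK ?fin_num_cdf.
under eq_integral do rewrite EFinB fineK ?fin_num_cdf//.
by rewrite integral_dist_cdf0; case/integrableP : iX.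
Qed.

Lemma integrable_C1 (X : {RV P >-> R}) (f df : R -> R) (L : R) :
  (forall t : R, is_derive t 1 f (df t)) -> continuous df ->
  (forall t, `|df t| <= L) -> P.-integrable setT (EFin \o X) ->
  P.-integrable setT (EFin \o (f \o X)).
Proof.
move=> df_ cont_df dfL iX.
have ic : P.-integrable setT (fun=> `|f 0|%:E) by exact: finite_measure_integrable_cst.
have iZ := integrableZl measurableT L (integrable_norm iX).
apply: le_integrable (integrableD measurableT ic iZ) => //.
  apply/measurable_EFinP; apply: measurableT_comp => //.
  by apply: continuous_measurable_fun; exact: is_derive_continuous df_.
move=> w _ /=; rewrite lee_fin.
rewrite [leRHS]ger0_norm; last by rewrite addr_ge0// mulr_ge0// (le_trans _ (dfL 0)).
have -> : f (X w) = f 0 + (f (X w) - f 0) by ring.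
rewrite (le_trans (ler_normD _ _))// lerD2l.
by rewrite -{2}[X w]subr0 (is_derive_lipschitz _ _ df_ dfL).
Qed.

(** An integration by parts in Fubini form. In the difference of two such identities both [f 0] and
    the step at [0] cancel, leaving [df] integrated against the difference of the distribution
    functions: the easy half of Kantorovich-Rubinstein duality. *)
Lemma Rintegral_C1 (X : {RV P >-> R}) (f df : R -> R) (L : R) :
  (forall t : R, is_derive t 1 f (df t)) -> continuous df ->
  (forall t, `|df t| <= L) -> P.-integrable setT (EFin \o X) ->
  \int[P]_w f (X w) - f 0 = \int[mu]_t (df t * ((0 <= t)%R%:R - fine (cdf X t))).
Proof.
move=> df_ cont_df dfL iX.
rewrite [RHS]/Rintegral -(integral_cdf (M := L))//; last exact: continuous_measurable_fun.
under [in RHS]eq_integral do rewrite (primitive_steps _ df_ cont_df dfL).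
rewrite -[RHS]/(\int[P]_w (f (X w) - f 0)).
rewrite RintegralB//; last 2 first.
- exact: integrable_C1 iX.
- exact: finite_measure_integrable_cst.
by rewrite Rintegral_cst_probability.
Qed.

End duality.

Lemma measurable_dist_cdf0 {R : realType} d (T : measurableType d)
    (P : probability T R) (X : {RV P >-> R}) :
  measurable_fun setT (fun t : R => `|(0 <= t)%R%:R%:E - cdf X t|%E).
Proof.
apply: measurableT_comp => //; apply: emeasurable_funB; last exact: cdf_measurable.
by apply/measurable_EFinP; exact: measurable_step.
Qed.

Section duality_two.
Context {R : realType}.
Context d (T : measurableType d) (P : probability T R).
Context d' (T' : measurableType d') (P' : probability T' R).
Local Notation mu := (@lebesgue_measure R).
Variables (X : {RV P >-> R}) (Y : {RV P' >-> R}).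
Hypothesis iX : P.-integrable setT (EFin \o X).

Lemma measurable_dist_cdf : measurable_fun setT (fun t => `|cdf Y t - cdf X t|%E).
Proof.
by apply: measurableT_comp => //; apply: emeasurable_funB; exact: cdf_measurable.
Qed.

(** A zero biased variable need not be integrable, as its first absolute moment involves a third
    moment of the original one. When the distance is finite, the triangle inequality through the
    step at [0] bounds [E |Y|] by [E |X|] plus that distance. *)
Lemma integrable_of_L1dist : (L1dist (cdf Y) (cdf X) < +oo)%E ->
  P'.-integrable setT (EFin \o Y).
Proof.
move=> XYoo; apply/integrableP; split; first exact/measurable_EFinP.
rewrite -[ltLHS]integral_dist_cdf0.
apply: (@le_lt_trans _ _ (\int[mu]_t (`|(0 <= t)%R%:R%:E - cdf X t| +
    `|cdf Y t - cdf X t|)))%E.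
  apply: ge0_le_integral => //.
  - exact: measurable_dist_cdf0.
  - by apply: emeasurable_funD; [exact: measurable_dist_cdf0|exact: measurable_dist_cdf].
  - move=> t _.
    rewrite -[cdf X t]fineK ?fin_num_cdf// -[cdf Y t]fineK ?fin_num_cdf//.
    rewrite -!EFinB/= -EFinD lee_fin.
    have -> : (0 <= t)%R%:R - fine (cdf Y t) =
      ((0 <= t)%R%:R - fine (cdf X t)) - (fine (cdf Y t) - fine (cdf X t)) by ring.
    exact: ler_normB.
rewrite ge0_integralD//; last 2 first.
- exact: measurable_dist_cdf0.
- exact: measurable_dist_cdf.
rewrite lte_add_pinfty//.
by rewrite integral_dist_cdf0; case/integrableP : iX.
Qed.

Variable D : R.
Hypothesis XYD : L1dist (cdf Y) (cdf X) = D%:E.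

Lemma C1_duality (f df : R -> R) (L : R) :
  (forall t : R, is_derive t 1 f (df t)) -> continuous df ->
  (forall t, `|df t| <= L) ->
  `|\int[P']_w f (Y w) - \int[P]_w f (X w)| <= L * D.
Proof.
move=> df_ cont_df dfL.
have iY : P'.-integrable setT (EFin \o Y).
  by apply: integrable_of_L1dist; rewrite XYD ltry.
have -> : \int[P']_w f (Y w) - \int[P]_w f (X w) =
    (\int[P']_w f (Y w) - f 0) - (\int[P]_w f (X w) - f 0) by ring.
rewrite !(Rintegral_C1 df_ cont_df dfL)//.
have mdf : measurable_fun setT df by exact: continuous_measurable_fun.
have jX := integrable_mul_bounded mdf dfL (integrable_cdf0 iX).
have jY := integrable_mul_bounded mdf dfL (integrable_cdf0 iY).
rewrite -RintegralB// (le_trans (le_normr_Rintegral _ (integrableB _ jY jX)))//.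
have eD : (\int[mu]_t (`|fine (cdf Y t) - fine (cdf X t)|%R)%:E = D%:E)%E.
  rewrite -XYD; apply: eq_integral => t _.
  by rewrite -[in RHS](fineK (fin_num_cdf X t)) -[in RHS](fineK (fin_num_cdf Y t)).
have iD : mu.-integrable setT
    (fun t => (`|fine (cdf Y t) - fine (cdf X t)|%R)%:E).
  apply/integrableP; split.
    apply: eq_measurable_fun measurable_dist_cdf => t _.
    by rewrite -[in LHS](fineK (fin_num_cdf X t)) -[in LHS](fineK (fin_num_cdf Y t)).
  under eq_integral do rewrite /= normr_id.
  by rewrite eD ltry.
have -> : D = \int[mu]_t `|fine (cdf Y t) - fine (cdf X t)| by rewrite /Rintegral eD.
rewrite -RintegralZl//; apply: le_Rintegral => //.
- exact: integrable_norm (integrableB measurableT jY jX).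
- exact: integrableZl iD.
move=> t _; rewrite -mulrBr normrM.
rewrite (_ : _ - _ - _ = - (fine (cdf Y t) - fine (cdf X t))); last ring.
by rewrite normrN ler_wpM2r.
Qed.

(** The Lipschitz function [df] is only differentiable almost everywhere; the
    difference quotients of its primitive [f] are C1 and converge to it. *)
Lemma lipschitz_duality (f df : R -> R) (M L : R) :
  (forall t : R, is_derive t 1 f (df t)) -> (forall t, `|df t| <= M) ->
  (forall x y, `|df y - df x| <= L * `|y - x|) ->
  `|\int[P']_w df (Y w) - \int[P]_w df (X w)| <= L * D.
Proof.
move=> df_ dfM dfL.
have L0 : 0 <= L by have := dfL 0 1; rewrite subr0 normr1 mulr1; apply: le_trans.
apply/ler_addgt0Pr => e e0.
have cont_df : continuous df := lipschitz_continuous dfL.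
(* Replacing [df] by the difference quotient [g] costs [L * dl] for each of the two variables, and
   [2 * L * dl <= e]; the added [1] covers [L = 0]. *)
pose dl := e / (2 * L + 1).
have L1 : 0 < 2 * L + 1 by rewrite ltr_wpDl// mulr_ge0.
have dl0 : 0 < dl by rewrite divr_gt0.
pose g x := dl^-1 * (f (x + dl) - f x).
pose dg x := dl^-1 * (df (x + dl) - df x).
have gdg (x : R) : is_derive x 1 g (dg x).
  have ? := df_ x; have ? := df_ (x + dl).
  by rewrite /g; apply: is_derive_eq; rewrite /GRing.scale/= /dg addr0 mulr1.
have gdf x : `|g x - df x| <= L * dl.
  have xdl : x < x + dl by rewrite ltrDl.
  have [|c] := MVT xdl (fun z _ => df_ z).
    exact/continuous_subspaceT/is_derive_continuous.
  rewrite in_itv/= => /andP[xc cx]; rewrite /g => ->.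
  rewrite addrAC subrr add0r mulrCA mulVf ?gt_eqF// mulr1.
  rewrite (le_trans (dfL _ _))// ler_wpM2l// ger0_norm; last by rewrite subr_ge0 ltW.
  by rewrite lerBlDl ltW.
have dgL x : `|dg x| <= L.
  rewrite /dg normrM normfV (gtr0_norm dl0) ler_pdivrMl//.
  by rewrite (le_trans (dfL _ _))// addrAC subrr add0r mulrC (gtr0_norm dl0).
have cdg : continuous dg.
  move=> x; apply: cvgM; first exact: cvg_cst.
  apply: cvgB; last exact: cont_df.
  apply: (@continuous_comp _ _ _ (fun x => x + dl) df); last exact: cont_df.
  by apply: cvgD; [exact: cvg_id|exact: cvg_cst].
have ib d1 (T1 : measurableType d1) (P1 : probability T1 R) (Z : {RV P1 >-> R}) :
    P1.-integrable setT (EFin \o Z) ->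
    `|\int[P1]_w g (Z w) - \int[P1]_w df (Z w)| <= L * dl.
  move=> iZ.
  have igZ : P1.-integrable setT (EFin \o (fun w => g (Z w))).
    exact: integrable_C1 gdg cdg dgL iZ.
  have idZ : P1.-integrable setT (EFin \o (fun w => df (Z w))).
    apply: (@integrable_bounded _ _ _ _ _ M) => //.
    by apply: measurableT_comp => //; exact: continuous_measurable_fun.
  rewrite -RintegralB// (le_trans (le_normr_Rintegral _ (integrableB _ igZ idZ)))//.
  apply: (@le_trans _ _ (\int[P1]_w (L * dl))).
    apply: le_Rintegral => //.
    - exact: integrable_norm (integrableB measurableT igZ idZ).
    - exact: finite_measure_integrable_cst.
  by rewrite Rintegral_cst_probability.
have iY : P'.-integrable setT (EFin \o Y).
  by apply: integrable_of_L1dist; rewrite XYD ltry.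
have h1 := C1_duality gdg cdg dgL.
have h2 := ib _ _ _ _ iX; have h3 := ib _ _ _ _ iY.
have h4 : 2 * (L * dl) <= e.
  have -> : 2 * (L * dl) = e * (2 * L / (2 * L + 1)) by rewrite /dl; field; rewrite gt_eqF.
  by rewrite ger_pMr// ler_pdivrMr// mul1r lerDl.
have -> : \int[P']_w df (Y w) - \int[P]_w df (X w) =
    (\int[P']_w g (Y w) - \int[P]_w g (X w))
    - (\int[P']_w g (Y w) - \int[P']_w df (Y w))
    + (\int[P]_w g (X w) - \int[P]_w df (X w)) by ring.
apply: (le_trans (ler_normD _ _)).
apply: (le_trans (lerD (ler_normB _ _) h2)).
lra.
Qed.

End duality_two.

(** * Independence *)

Section independence.
Context {R : realType} d (T : measurableType d) (P : probability T R).

Definition independent_pair (X V : {RV P >-> R}) : Prop :=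
  forall B C : set R, measurable B -> measurable C ->
    (P (X @^-1` B `&` V @^-1` C) = P (X @^-1` B) * P (V @^-1` C))%E.

(** A pi-system argument. The rectangles in the coordinates [j != i] are stable under intersection,
    and on them the finite measures [A |-> P (A & X_i in B)] and [A |-> P (X_i in B) P A] agree by
    mutual independence; hence they agree on the generated sigma-algebra, which contains the events
    of [V]. *)
Lemma mutually_independent_rest (n : nat) (X : 'I_n -> {RV P >-> R}) (i : 'I_n)
    (c : R) (V : {RV P >-> R}) : mutually_independent X ->
  (forall w, V w = c * \sum_(j < n | j != i) X j w) -> independent_pair (X i) V.
Proof.
move=> indX VE B C mB mC.
pose G : set (set T) := [set A | exists2 Bs : 'I_n -> set R,
  (forall j, measurable (Bs j)) &
  A = \bigcap_(j in [set` [set j | j != i]%SET]) (X j @^-1` Bs j)].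
have mXB : measurable (X i @^-1` B) by exact: measurable_funPTI.
have GT : G setT.
  exists (fun=> setT) => [//|].
  by apply/esym; rewrite -subTset => w _ j _.
have Gm : G `<=` measurable.
  move=> _ [Bs mBs ->]; apply: fin_bigcap_measurable => // j _.
  exact: measurable_funPTI.
have GI : setI_closed G.
  move=> _ _ [Bs mBs ->] [Cs mCs ->]; exists (fun j => Bs j `&` Cs j).
    by move=> j; exact: measurableI.
  rewrite -bigcapI; apply: eq_bigcapr => j _.
  by rewrite preimage_setI.
have sV : <<s G >> (V @^-1` C).
  (* With [T] re-equipped with the sigma-algebra generated by [G], the claim becomes measurability
     of [V], a multiple of a finite sum of measurable coordinates. *)
  pose GT' := g_sigma_algebraType G.
  have mXj j : j != i -> measurable_fun setT (X j : GT' -> R).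
    move=> ji _ D mD; rewrite setTI; apply: sub_sigma_algebra.
    exists (fun k => if k == j then D else setT).
      by move=> k; case: ifP.
    apply/seteqP; split=> [w Dw k _ /=|w /(_ j)].
      by case: eqP => [->|].
    by rewrite eqxx; apply; rewrite /= inE.
  have mV : measurable_fun setT (V : GT' -> R).
    rewrite (_ : (V : GT' -> R) =
        fun w => c * \sum_(j < n) (if j != i then X j w else 0)); last first.
      by apply/funext => w; rewrite VE [in LHS]big_mkcond.
    apply: measurable_funM => //; apply: measurable_sum => j.
    by case: (boolP (j != i)) => ji //; exact: mXj.
  by rewrite -[X in <<s _ >> X]setTI; exact: mV.
have p0 : 0 <= fine (P (X i @^-1` B)) by rewrite fine_ge0.
have := @g_sigma_algebra_measure_unique _ _ _ G Gm (fun=> setT) (fun=> GT) _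
  (mrestr P mXB) (mscale (NngNum p0) P) GI _ _ _ sV.
have m2E A : mscale (NngNum p0) P A = (P (X i @^-1` B) * P A)%E.
  by rewrite -[LHS]/((fine (P (X i @^-1` B)))%:E * P A)%E fineK ?fin_num_measure.
move=> h; rewrite setIC; apply: etrans (h _ _ _) (m2E _).
- by rewrite bigcup_const.
- move=> _ [Bs mBs ->]; apply: etrans (esym (m2E _)); rewrite -[LHS]/(P (_ `&` _)).
  pose Cs j := if j == i then B else Bs j.
  have mCs j : measurable (Cs j) by rewrite /Cs; case: ifP.
  have -> : \bigcap_(j in [set` [set j | j != i]%SET]) (X j @^-1` Bs j) `&` X i @^-1` B =
      \bigcap_(j in [set` [set: 'I_n]%SET]) (X j @^-1` Cs j).
    apply/seteqP; split=> [w [wBs wB] j _|w wC].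
      rewrite /Cs /=; case: eqP => [->//|/eqP ji].
      by apply: wBs; rewrite /= inE.
    split=> [j|]; last first.
      by have := wC i; rewrite /= inE /Cs eqxx; apply.
    by rewrite /= inE => ji; have := wC j; rewrite /= inE /Cs (negbTE ji); apply.
  rewrite (indX _ Cs (fun j _ => mCs j)) (indX _ Bs (fun j _ => mBs j)).
  rewrite (bigD1 i) ?inE//= /Cs eqxx; congr (_ * _)%E.
  apply: eq_big => [j|j /andP[_ ji]]; first by rewrite !inE.
  by rewrite (negbTE ji).
- move=> _; rewrite -[ltLHS]/(P (_ `&` _)) -ge0_fin_numE// fin_num_measure//.
  exact: measurableI.
Qed.

(** Conditioning on [V]: the joint law is a product, Fubini freezes the second coordinate at [v],
    and a bound uniform in [v] survives integration. Integrability at each frozen [v] is a separate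
    hypothesis because Fubini yields it only for almost every [v]. *)
Lemma independent_pair_bound (X V : {RV P >-> R}) (h : R * R -> R) (K : R) :
  independent_pair X V -> measurable_fun setT h ->
  P.-integrable setT (EFin \o (fun w => h (X w, V w))) ->
  (forall v, P.-integrable setT (EFin \o (fun w => h (X w, v)))) ->
  (forall v, `|\int[P]_w h (X w, v)| <= K) ->
  `|\int[P]_w h (X w, V w)| <= K.
Proof.
move=> XV mh ih ihv hK.
have mXV : measurable_fun setT (fun w => (X w, V w)) by exact: measurable_fun_pair.
pose XV_isM := isMeasurableFun.Build _ _ T (R * R)%type _ mXV.
pose Z : {mfun T >-> (R * R)%type} := HB.pack (fun w => (X w, V w)) XV_isM.
have mhE : measurable_fun setT (EFin \o h) by exact/measurable_EFinP.
have ZE A : measurable A -> (distribution P X \x distribution P V)%E A = distribution P Z A.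
  apply: product_measure_unique => B C mB mC.
  exact: XV.
pose mX := distribution P X; pose mV := distribution P V.
have ihZ : (mX \x mV)%E.-integrable setT (EFin \o h).
  apply/integrableP; split => //.
  rewrite (eq_measure_integral (distribution P Z)) => [|A mA _]; last exact: ZE.
  rewrite ge0_integral_distribution//; last exact: measurableT_comp.
  by case/integrableP : ih.
have innerE v : (\int[mX]_x (h (x, v))%:E = \int[P]_w (h (X w, v))%:E)%E.
  rewrite integral_distribution//.
    exact: (measurableT_comp mhE (measurable_pair2 _)).
  exact: ihv.
have eZ : (\int[P]_w (h (X w, V w))%:E =
    \int[mV]_v \int[P]_w (h (X w, v))%:E)%E.
  rewrite -[LHS](@integral_distribution _ _ _ _ _ P Z (EFin \o h))//.
  rewrite -(eq_measure_integral _ (fun A mA _ => ZE A mA)).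
  rewrite -integral21_prod_meas1//.
  by apply: eq_integral => v _; exact: innerE.
have mI : measurable_fun setT (fun v => \int[P]_w (h (X w, v))%:E)%E.
  apply: eq_measurable_fun (measurable_fubini_G ihZ) => v _.
  exact: innerE.
rewrite -lee_fin EFin_normr_Rintegral// eZ.
apply: (le_trans (le_abse_integral _ _ mI)) => //.
apply: (@le_trans _ _ (\int[mV]_v K%:E)%E).
  apply: ge0_le_integral => //; first exact: measurableT_comp.
  by move=> v _; rewrite -EFin_normr_Rintegral// lee_fin hK.
rewrite integral_cst// -[leRHS]mule1 lee_wpmul2l//.
  by rewrite lee_fin (le_trans _ (hK 0)).
exact: probability_le1.
Qed.

End independence.

(** * The bound for scaled sums *)

Section stein_L1.
Context {R : realType} d (T : measurableType d) (P : probability T R).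
Local Notation mu := (@lebesgue_measure R).

Lemma stein_HE (s : R -> R) (x : R) :
  measurable_fun setT s -> (forall t, `|s t| <= 1) ->
  stein_H s x = \int[mu]_t (s t * (Phi t - (x <= t)%R%:R)).
Proof.
move=> ms s1; rewrite /stein_H /stein_U /stein_V -RintegralB//; last 2 first.
- exact: integrable_bounded_mul (integrable_below x).
- exact: integrable_bounded_mul (integrable_above x).
apply: eq_Rintegral => t _; rewrite /below /above; case: leP => _ /=; ring.
Qed.

Lemma integrable_PhiB (x : R) :
  mu.-integrable setT (fun t => (Phi t - (x <= t)%R%:R)%:E).
Proof.
have := integrableB measurableT (integrable_below x) (integrable_above x).
apply: eq_integrable => // t _ /=.
by rewrite -EFinB /below /above; case: leP => _ /=; congr _%:E; ring.
Qed.

Lemma L1dist_normal (W : {RV P >-> R}) : P.-integrable setT (EFin \o W) ->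
  exists s : R -> R, [/\ measurable_fun setT s, forall t, `|s t| <= 1 &
    L1dist (cdf W) (@std_normal_cdf R) =
      (\int[P]_w (stein_g s (W w) - W w * stein_f s (W w)))%:E].
Proof.
move=> iW.
pose F t := fine (cdf W t).
have mF : measurable_fun setT F.
  apply/measurable_EFinP; apply: eq_measurable_fun (cdf_measurable W) => t _ /=.
  by rewrite fineK ?fin_num_cdf.
(* The sign of [Phi - F], equal to [0] at ties; as a difference of two steps it is visibly
   measurable. *)
pose s t := (F t <= Phi t)%R%:R - (Phi t <= F t)%R%:R : R.
have ms : measurable_fun setT s.
  by apply: measurable_funB; apply: measurable_step => //; exact: measurable_Phi.
have s1 t : `|s t| <= 1.
  rewrite /s; case: (ltgtP (F t) (Phi t)) => _ /=.
  - by rewrite subr0 normr1.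
  - by rewrite sub0r normrN normr1.
  - by rewrite subrr normr0.
have sE t : s t * (Phi t - F t) = `|F t - Phi t|.
  rewrite /s; case: (ltgtP (F t) (Phi t)) => h /=.
  - by rewrite subr0 mul1r distrC ger0_norm// subr_ge0 ltW.
  - by rewrite sub0r mulN1r opprB ger0_norm// subr_ge0 ltW.
  - by rewrite h !subrr mul0r normr0.
exists s; split => //.
have iPhi0 := integrable_mul_bounded ms s1 (integrable_PhiB 0).
have iF0 := integrable_mul_bounded ms s1 (integrable_cdf0 iW).
have HB x : stein_H s x - stein_H s 0 =
    \int[mu]_t (s t * ((0 <= t)%R%:R - (x <= t)%R%:R)).
  rewrite !stein_HE// -RintegralB//; last first.
    exact: integrable_mul_bounded ms s1 (integrable_PhiB x).
  by apply: eq_Rintegral => t _; ring.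
have iN : mu.-integrable setT (fun t => (`|F t - Phi t|)%:E).
  have := integrableD measurableT iPhi0 iF0; apply: eq_integrable => // t _ /=.
  by rewrite -EFinD -sE -/(F t); congr _%:E; ring.
have iH : P.-integrable setT (EFin \o (fun w => stein_H s (W w))).
  pose M : R := 2 * (normal_peak 1 + 1).
  have iM : P.-integrable setT (cst M%:E) by exact: finite_measure_integrable_cst.
  (* The Stein equation read backwards: bounded continuous [stein_g] and [stein_f] make [stein_H]
     measurable and of linear growth. *)
  have Hgf x : stein_H s x = stein_g s x - x * stein_f s x.
    by rewrite /stein_g addrAC subrr add0r.
  apply: le_integrable (integrableD measurableT iM (integrable_norm iW)) => //.
    apply/measurable_EFinP; apply: measurableT_comp => //.
    rewrite (funext Hgf); apply: continuous_measurable_fun => x.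
    apply: cvgB; first exact: (lipschitz_continuous (stein_g_lipschitz ms s1)).
    apply: cvgM; first exact: cvg_id.
    exact: (is_derive_continuous (is_derive_stein_f ms s1)).
  move=> w _ /=; rewrite lee_fin Hgf (le_trans (ler_normB _ _))//.
  rewrite [leRHS]ger0_norm; last first.
    by rewrite addr_ge0// mulr_ge0// addr_ge0// normal_peak_ge0.
  by rewrite lerD ?stein_g_bounded// normrM ler_piMr// stein_f_le1.
have -> : \int[P]_w (stein_g s (W w) - W w * stein_f s (W w)) =
    \int[mu]_t (`|F t - Phi t|).
  transitivity (\int[P]_w stein_H s (W w)).
    by apply: eq_Rintegral => w _; rewrite /stein_g addrAC subrr add0r.
  (* [integral_cdf] handles integrands compensated by the step at [0], that is
     [stein_H s x - stein_H s 0]; hence both sides are shifted by the same constant. *)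
  apply: (addIr (- stein_H s 0)).
  transitivity (\int[P]_w (stein_H s (W w) - stein_H s 0)).
    rewrite RintegralB//; last exact: finite_measure_integrable_cst.
    by rewrite Rintegral_cst_probability.
  rewrite /Rintegral; under eq_integral do rewrite HB.
  rewrite (integral_cdf ms s1 iW) -/(Rintegral mu setT _).
  rewrite [in RHS]stein_HE// -RintegralB//.
  by apply: eq_Rintegral => t _; rewrite -sE -/(F t); ring.
rewrite /Rintegral fineK; last exact: integrable_fin_num iN.
apply: eq_integral => t _.
by rewrite -PhiE -[in LHS](fineK (fin_num_cdf W t)).
Qed.

Lemma Rintegral_sum (I : Type) (r : seq I) (f : I -> T -> R) :
  (forall i, P.-integrable setT (EFin \o f i)) ->
  \int[P]_w (\sum_(i <- r) f i w) = \sum_(i <- r) \int[P]_w f i w.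
Proof.
move=> intf; elim: r => [|i r ih].
  by rewrite big_nil; under eq_Rintegral do rewrite big_nil; rewrite Rintegral_cst ?mul0r.
rewrite big_cons -ih -RintegralD//; first by apply: eq_Rintegral => w _; rewrite big_cons.
have := integrable_sum measurableT r (fun i (_ : xpredT i) => intf i).
by apply: eq_integrable => // w _; rewrite /= sumEFin.
Qed.

End stein_L1.

(** * Zero bias identity for bounded C1 test functions *)

Section zero_bias.
Context {R : realType} d (T : measurableType d) (P : probability T R).
Context d' (T' : measurableType d') (P' : probability T' R).

Lemma lipschitz_abs_continuous (f : R -> R) (L : R) :
  (forall x y, `|f y - f x| <= L * `|y - x|) -> abs_continuous f.
Proof.
move=> fL a b e e0.
have L1 : 0 < `|L| + 1 by rewrite ltr_wpDl.
exists (e / (`|L| + 1)); first by rewrite divr_gt0.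
move=> m u v uv _; rewrite ltr_pdivlMr// mulrC; apply: le_lt_trans.
rewrite mulr_sumr; apply: ler_sum => k _.
have [_ [uvk _]] := uv k.
rewrite (le_trans (fL _ _))// ger0_norm ?subr_ge0// ler_wpM2r ?subr_ge0//.
by rewrite (le_trans (ler_norm _))// lerDl.
Qed.

Lemma zero_biased_C1 (X : {RV P >-> R}) (Xs : {RV P' >-> R}) (f df : R -> R)
    (K M : R) :
  zero_biased X Xs -> ('V_P[X] \is a fin_num)%E -> P.-integrable setT (EFin \o X) ->
  (forall x : R, is_derive x 1 f (df x)) -> continuous df ->
  (forall x, `|f x| <= K) -> (forall x, `|df x| <= M) ->
  \int[P]_w (X w * f (X w)) = fine 'V_P[X] * \int[P']_w df (Xs w).
Proof.
move=> zX Vfin iX df_ cont_df fK dfM.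
have derE x : derive1 f x = df x.
  by rewrite derive1E; exact: (@derive_val _ _ _ _ _ _ _ (df_ x)).
have iXf : P.-integrable setT (fun w => (X w * f (X w))%:E).
  have iK := integrableZl measurableT K (integrable_norm iX).
  apply: le_integrable iK => //.
    apply/measurable_EFinP; apply: measurable_funM => //; apply: measurableT_comp => //.
    by apply: continuous_measurable_fun; exact: is_derive_continuous df_.
  move=> w _ /=; rewrite lee_fin !normrM mulrC ler_pM ?normr_id//.
  by rewrite (le_trans (fK _))// ler_norm.
have iXs : P'.-integrable setT (fun w => (derive1 f (Xs w))%:E).
  under eq_fun do rewrite derE.
  apply: (@integrable_bounded _ _ _ _ _ M) => //.
  by apply: measurableT_comp => //; exact: continuous_measurable_fun.
have := zX f (lipschitz_abs_continuous (fun x y => is_derive_lipschitz x y df_ dfM)) iXf iXs.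
rewrite unlock /Rintegral => ->.
rewrite fineM//.
  by congr (_ * fine _); apply: eq_integral => w _; rewrite derE.
exact: integrable_fin_num iXs.
Qed.

End zero_bias.

Section stein_bound.
Context {R : realType} d (T : measurableType d) (P : probability T R).
Context d' (T' : measurableType d') (P' : probability T' R).

Section one_summand.
Variables (X : {RV P >-> R}) (Xs : {RV P' >-> R}) (s : R -> R) (c v : R).
Hypotheses (ms : measurable_fun setT s) (s1 : forall t, `|s t| <= 1).
Hypotheses (zX : zero_biased X Xs) (Vfin : ('V_P[X] \is a fin_num)%E).
Hypotheses (iX : P.-integrable setT (EFin \o X)) (c0 : 0 < c).

Let f x := stein_f s (c * x + v).
Let df x := c * stein_g s (c * x + v).
Let M : R := c * (2 * (normal_peak 1 + 1)).

Let df_ (x : R) : is_derive x 1 f (df x).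
Proof.
have ? := is_derive_stein_f ms s1 (c * x + v).
by apply: is_derive_eq; rewrite /GRing.scale/= /df; ring.
Qed.

Let dfM x : `|df x| <= M.
Proof. by rewrite normrM (gtr0_norm c0) ler_pM2l// stein_g_bounded. Qed.

Let df_lipschitz x y : `|df y - df x| <= 2 * c ^+ 2 * `|y - x|.
Proof.
rewrite -mulrBr normrM (gtr0_norm c0).
have -> : 2 * c ^+ 2 * `|y - x| = c * (2 * `|(c * y + v) - (c * x + v)|).
  rewrite (_ : _ + v - _ = c * (y - x)); last ring.
  by rewrite normrM (gtr0_norm c0); ring.
by rewrite ler_pM2l// stein_g_lipschitz.
Qed.

Let idf : P.-integrable setT (EFin \o (fun w => df (X w))).
Proof.
apply: (@integrable_bounded _ _ _ _ _ M) => //.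
apply: measurableT_comp => //; apply: continuous_measurable_fun.
exact: lipschitz_continuous df_lipschitz.
Qed.

Let ixf : P.-integrable setT (EFin \o (fun w => X w * f (X w))).
Proof.
have mf : measurable_fun setT (fun w => f (X w)).
  apply: measurableT_comp => //; apply: continuous_measurable_fun.
  exact: is_derive_continuous df_.
apply: le_integrable iX => //.
  by apply/measurable_EFinP; exact: measurable_funM.
by move=> w _ /=; rewrite lee_fin normrM ler_piMr// stein_f_le1.
Qed.

Lemma integrable_stein_summand :
  P.-integrable setT (EFin \o (fun w => c * X w * stein_f s (c * X w + v) -
    c ^+ 2 * fine 'V_P[X] * stein_g s (c * X w + v))).
Proof.
have := integrableB measurableT (integrableZl measurableT c ixf)
  (integrableZl measurableT (c * fine 'V_P[X]) idf).
apply: eq_integrable => // w _ /=.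
by rewrite -!EFinM -EFinB /f /df; congr _%:E; ring.
Qed.

(** The zero bias identity for [f] turns the first term into [c * V * E df(Xs)]. The second is
    [c * V * E df(X)], because one factor [c] of [c ^+ 2] is absorbed by the chain rule in [df]. *)
Lemma Rintegral_stein_summand :
  \int[P]_w (c * X w * stein_f s (c * X w + v) -
     c ^+ 2 * fine 'V_P[X] * stein_g s (c * X w + v)) =
  c * fine 'V_P[X] * (\int[P']_w df (Xs w) - \int[P]_w df (X w)).
Proof.
rewrite mulrBr -[in c * _ * \int[P']_w _]mulrA.
rewrite -(zero_biased_C1 zX Vfin iX df_ _ (K := 1) (M := M))//; last 2 first.
- exact: lipschitz_continuous df_lipschitz.
- by move=> x; exact: stein_f_le1.
rewrite -!RintegralZl// -RintegralB//; last 2 first.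
- exact: integrableZl ixf.
- exact: integrableZl idf.
by apply: eq_Rintegral => w _; rewrite /f /df; ring.
Qed.

(** If the [L1] distance is infinite, the hypothesis forces the variance to be
    [0], thanks to [0 * +oo = 0]. *)
Lemma Rintegral_stein_summand_le (K : R) :
  ((2 * c ^+ 3)%:E * ('V_P[X] * L1dist (cdf Xs) (cdf X)) = K%:E)%E ->
  `|\int[P]_w (c * X w * stein_f s (c * X w + v) -
     c ^+ 2 * fine 'V_P[X] * stein_g s (c * X w + v))| <= K.
Proof.
have V0 : (0 <= 'V_P[X])%E by exact: variance_ge0.
have D0 : (0 <= L1dist (cdf Xs) (cdf X))%E by apply: integral_ge0.
rewrite Rintegral_stein_summand -(fineK Vfin).
have := fine_ge0 V0; rewrite le_eqVlt => /predU1P[<-|V1].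
  by rewrite mul0e mule0 mulr0 mul0r normr0 => -[->].
have c3 : 0 < 2 * c ^+ 3 by rewrite mulr_gt0// exprn_gt0.
case XD : (L1dist (cdf Xs) (cdf X)) D0 => [D| |//] _.
  rewrite -!EFinM => -[<-].
  rewrite normrM (gtr0_norm (mulr_gt0 c0 V1)).
  have -> : 2 * c ^+ 3 * (fine 'V_P[X] * D) = c * fine 'V_P[X] * (2 * c ^+ 2 * D) by ring.
  rewrite ler_pM2l ?mulr_gt0//.
  exact (lipschitz_duality iX XD df_ dfM df_lipschitz).
by rewrite !gt0_muley ?lte_fin.
Qed.

End one_summand.

Lemma stein_zero_bias_bound (n : nat) (X : 'I_n -> {RV P >-> R}) (c : R)
    (W : {RV P >-> R}) (Xs : 'I_n -> {RV P' >-> R}) :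
  mutually_independent X -> (forall i, P.-integrable setT (EFin \o X i)) ->
  (forall i, 'V_P[X i] \is a fin_num)%E -> 0 < c ->
  \sum_(i < n) c ^+ 2 * fine 'V_P[X i] = 1 ->
  (forall w, W w = c * \sum_(i < n) X i w) ->
  (forall i, zero_biased (X i) (Xs i)) ->
  (L1dist (cdf W) (@std_normal_cdf R) <=
   \sum_(i < n) (2 * c ^+ 3)%:E * ('V_P[X i] * L1dist (cdf (Xs i)) (cdf (X i))))%E.
Proof.
move=> indX iX Vfin c0 sumV WE zX.
set K := fun i => ((2 * c ^+ 3)%:E * ('V_P[X i] * L1dist (cdf (Xs i)) (cdf (X i))))%E.
have K0 i : (0 <= K i)%E.
  apply: mule_ge0; first by rewrite lee_fin mulr_ge0// exprn_ge0// ltW.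
  by apply: mule_ge0; [exact: variance_ge0|exact: integral_ge0].
(* An infinite right-hand side is trivial. Otherwise each [K i] is a real number, although the
   distance in it may still be infinite if the variance is [0]. *)
have [->|Sfin] := eqVneq (\sum_(i < n) K i)%E +oo%E; first exact: leey.
have Kfin i : K i \is a fin_num.
  rewrite ge0_fin_numE//; apply: (@le_lt_trans _ _ (\sum_(i < n) K i)%E).
    by rewrite (bigD1 i)//= leeDl// sume_ge0.
  by rewrite ltey.
have iW : P.-integrable setT (EFin \o W).
  have := integrableZl measurableT c
    (integrable_sum measurableT (index_enum 'I_n) (fun i (_ : xpredT i) => iX i)).
  by apply: eq_integrable => // w _; rewrite /= sumEFin -EFinM WE.
have [s [ms s1 ->]] := L1dist_normal iW.
rewrite -(eq_bigr _ (fun i _ => fineK (Kfin i))) sumEFin lee_fin.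
have exV i : exists V : {RV P >-> R}, forall w, V w = c * \sum_(j < n | j != i) X j w.
  have mV : measurable_fun setT (fun w => c * \sum_(j < n | j != i) X j w).
    under eq_fun do rewrite big_mkcond.
    apply: measurable_funM => //; apply: measurable_sum => j.
    by case: (j != i).
  pose V_isM := isMeasurableFun.Build _ _ T R _ mV.
  pose V : {mfun T >-> R} := HB.pack (fun w => c * \sum_(j < n | j != i) X j w) V_isM.
  by exists V.
have [V VE] := choice exV.
have WV i w : W w = c * X i w + V i w.
  by rewrite WE VE (bigD1 i)//= mulrDr.
pose h i (z : R * R) := c * z.1 * stein_f s (c * z.1 + z.2) -
  c ^+ 2 * fine 'V_P[X i] * stein_g s (c * z.1 + z.2).
have mf : measurable_fun setT (stein_f s).
  apply: continuous_measurable_fun.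
  exact: is_derive_continuous (is_derive_stein_f ms s1).
have mg : measurable_fun setT (stein_g s).
  apply: continuous_measurable_fun.
  exact: lipschitz_continuous (stein_g_lipschitz ms s1).
have mh i : measurable_fun setT (h i).
  have mz : measurable_fun setT (fun z : R * R => c * z.1 + z.2).
    by apply: measurable_funD => //; exact: measurable_funM.
  apply: measurable_funB; apply: measurable_funM => //.
  - exact: measurable_funM.
  - exact: measurableT_comp.
  - exact: measurableT_comp.
have ih i : P.-integrable setT (EFin \o (fun w => h i (X i w, V i w))).
  have iXf : P.-integrable setT (EFin \o (fun w => X i w * stein_f s (W w))).
    apply: le_integrable (iX i) => //.
      apply/measurable_EFinP; apply: measurable_funM => //; exact: measurableT_comp.
    by move=> w _ /=; rewrite lee_fin normrM ler_piMr// stein_f_le1.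
  have ig : P.-integrable setT (EFin \o (fun w => stein_g s (W w))).
    apply: (@integrable_bounded _ _ _ _ _ (2 * (normal_peak 1 + 1))) => [|w].
      exact: measurableT_comp.
    exact: stein_g_bounded.
  have := integrableB measurableT (integrableZl measurableT c iXf)
    (integrableZl measurableT (c ^+ 2 * fine 'V_P[X i]) ig).
  apply: eq_integrable => // w _ /=.
  by rewrite -!EFinM -EFinB /h/= -WV; congr _%:E; ring.
have hK i : `|\int[P]_w h i (X i w, V i w)| <= fine (K i).
  apply: independent_pair_bound => //.
  - exact: mutually_independent_rest (VE i).
  - by move=> v; exact: integrable_stein_summand.
  - move=> v; apply: Rintegral_stein_summand_le => //.
    by rewrite fineK.
(* The terms [c * X i] sum to [W], and the weights [c ^+ 2 * fine 'V_P[X i]] sum to [1], so the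
   single [stein_g s (W w)] can be distributed over the summands. *)
have -> : \int[P]_w (stein_g s (W w) - W w * stein_f s (W w)) =
    - \sum_(i < n) \int[P]_w h i (X i w, V i w).
  rewrite -Rintegral_sum// -[RHS]mulN1r -RintegralZl//; last first.
    have := integrable_sum measurableT (index_enum 'I_n) (fun i (_ : xpredT i) => ih i).
    by apply: eq_integrable => // w _; rewrite /= sumEFin.
  apply: eq_Rintegral => w _.
  rewrite /h/=; under eq_bigr do rewrite -WV.
  rewrite big_split/= sumrN -!mulr_suml -mulr_sumr -WE sumV; ring.
apply: le_trans (ler_norm _) _; rewrite normrN.
apply: le_trans (ler_norm_sum _ _ _) _.
by apply: ler_sum => i _; exact: hK.
Qed.

End stein_bound.

(** * Identically distributed summands and the random index *)

Section same_law.
Context {R : realType} d (T : measurableType d) (P : probability T R).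
Variables X Y : {RV P >-> R}.
Hypothesis XY : same_law X Y.

Lemma ge0_integral_same_law (f : R -> \bar R) : measurable_fun setT f ->
  (forall x, (0 <= f x)%E) -> (\int[P]_w f (X w) = \int[P]_w f (Y w))%E.
Proof.
move=> mf f0.
rewrite -(ge0_integral_distribution X mf f0) -(ge0_integral_distribution Y mf f0).
by apply: eq_measure_integral => A mA _; exact: XY.
Qed.

Lemma integrable_same_law (f : R -> R) : measurable_fun setT f ->
  P.-integrable setT (EFin \o (fun w => f (X w))) ->
  P.-integrable setT (EFin \o (fun w => f (Y w))).
Proof.
move=> mf /integrableP[_ ifoo]; apply/integrableP; split.
  by apply/measurable_EFinP; exact: measurableT_comp.
rewrite -(@ge0_integral_same_law (fun x => `|f x|%:E))//.
by apply/measurable_EFinP; exact: measurableT_comp.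
Qed.

Lemma integral_same_law (f : R -> R) : measurable_fun setT f ->
  P.-integrable setT (EFin \o (fun w => f (X w))) ->
  (\int[P]_w (f (X w))%:E = \int[P]_w (f (Y w))%:E)%E.
Proof.
move=> mf ifX; have ifY := integrable_same_law mf ifX.
have mfE : measurable_fun setT (EFin \o f) by exact/measurable_EFinP.
rewrite -(integral_distribution mfE ifX) -(integral_distribution mfE ifY).
by apply: eq_measure_integral => A mA _; exact: XY.
Qed.

Lemma cdf_same_law : cdf X = cdf Y.
Proof. by apply/funext => t; exact: XY. Qed.

End same_law.

Section same_law_moments.
Context {R : realType} d (T : measurableType d) (P : probability T R).

Lemma same_law_sym (X Y : {RV P >-> R}) : same_law X Y -> same_law Y X.
Proof. by move=> XY B mB; rewrite XY. Qed.

Lemma variance_same_law (X Y : {RV P >-> R}) : same_law X Y ->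
  P.-integrable setT (EFin \o X) -> ('V_P[X] = 'V_P[Y])%E.
Proof.
move=> XY iX.
have E : ('E_P[X] = 'E_P[Y])%E.
  by rewrite unlock; exact: (integral_same_law XY (f := id)).
rewrite /variance covariance.unlock E; set m := fine _; rewrite expectation.unlock.
rewrite -[LHS]/(\int[P]_w ((X w - m) * (X w - m))%:E)%E.
apply: (ge0_integral_same_law XY (f := fun x => ((x - m) * (x - m))%:E)).
  by apply/measurable_EFinP; apply: measurable_funM; apply: measurable_funB.
by move=> x; rewrite lee_fin -expr2 sqr_ge0.
Qed.

(** Applied to families consisting of one interval. It makes the test functions of [zero_biased]
    measurable, so that their expectations can be transported between equal laws. *)
Lemma abs_continuous_continuous (f : R -> R) : abs_continuous f -> continuous f.
Proof.
move=> acf x; apply/cvgrPdist_lt => /= e e0.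
have [dl dl0 dlP] := acf (x - 1) (x + 1) e e0.
near=> y.
have xydl : `|x - y| < dl by near: y; apply: cvgr_dist_lt => //; exact: cvg_id.
have xy1 : `|x - y| < 1 by near: y; apply: cvgr_dist_lt => //; exact: cvg_id.
have dist1 u v : x - 1 <= u -> u <= v -> v <= x + 1 -> v - u < dl -> `|f v - f u| < e.
  move=> xu uv vx uvdl; have := dlP 1%N (fun=> u) (fun=> v).
  rewrite !big_ord1; apply => //.
  by move=> i j _ _ _; rewrite !ord1.
move: (xydl) (xy1) => /ltr_normlP[h1 h2] /ltr_normlP[h3 h4].
have [xy|/ltW yx] := leP x y; last by apply: dist1 => //; lra.
by rewrite distrC; apply: dist1 => //; lra.
Unshelve. all: end_near. Qed.

Lemma zero_biased_same_law (X Y : {RV P >-> R})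
    d' (T' : measurableType d') (P' : probability T' R) (Xs : {RV P' >-> R}) :
  same_law X Y -> P.-integrable setT (EFin \o X) ->
  zero_biased X Xs -> zero_biased Y Xs.
Proof.
move=> XY iX zX f acf iYf iXs.
have mf : measurable_fun setT (fun x : R => x * f x).
  apply: measurable_funM => //; apply: continuous_measurable_fun.
  exact: abs_continuous_continuous.
have iXf := integrable_same_law (same_law_sym XY) mf iYf.
have := zX f acf iXf iXs; rewrite -(variance_same_law XY iX) => <-.
by rewrite unlock; exact: esym (integral_same_law XY mf iXf).
Qed.

End same_law_moments.

Section random_index.
Context {R : realType} d (T : measurableType d) (P : probability T R) (n : nat).
Variables (X Xs : 'I_n -> {RV P >-> R}) (J : T -> 'I_n).
Local Notation mu := (@lebesgue_measure R).
Hypothesis mJ : random_index J.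
Hypothesis indJ : index_independent_of_family (P := P) J
  (fun k : 'I_n + 'I_n => match k with inl i => X i | inr i => Xs i end).

(** Independence of the index is only needed on the events generating the laws
    of [X i] and [Xs i]. *)
Lemma prob_index_L1dist_le (i : 'I_n) :
  (P (J @^-1` [set i]) * L1dist (cdf (Xs i)) (cdf (X i)) <=
   \int[P]_w (\1_(J @^-1` [set i]) w * `|Xs i w - X i w|%R)%:E)%E.
Proof.
set A := J @^-1` [set i].
have mA : measurable A by exact: mJ.
pose Z (k : 'I_n + 'I_n) : {RV P >-> R} :=
  match k with inl i => X i | inr i => Xs i end.
have PAE k t : (P (A `&` Z k @^-1` `]-oo, t]) = P A * cdf (Z k) t)%E.
  apply: (indJ (A := A) (B := Z k @^-1` `]-oo, t])); first by exists [set i].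
  apply: sub_sigma_algebra; exists k => //=.
  by exists `]-oo, t]%classic => //; rewrite setTI.
apply: le_trans (dist_measure_le (Xs i) (X i) mA).
rewrite -ge0_integralZl//; last exact: measurable_dist_cdf.
apply: ge0_le_integral => //.
- by move=> t _; rewrite mule_ge0.
- by apply: measurable_funeM; exact: measurable_dist_cdf.
- apply: measurableT_comp => //.
  by apply: emeasurable_funB; exact: measurable_measure_step.
- move=> t _.
  have := PAE (inr i) t; have := PAE (inl i) t => /= -> ->.
  rewrite -muleBr ?fin_num_measure//; last first.
    by rewrite fin_num_adde_defl// fin_numN fin_num_cdf.
  by rewrite abseM (gee0_abs (measure_ge0 P A)).
Qed.

Lemma expectation_random_index :
  ('E_P[fun w => `|Xs (J w) w - X (J w) w|%R] =
   \sum_(i < n) \int[P]_w (\1_(J @^-1` [set i]) w * `|Xs i w - X i w|%R)%:E)%E.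
Proof.
rewrite unlock -ge0_integral_sum//; last first.
- move=> i; apply/measurable_EFinP; apply: measurable_funM.
    by apply: measurable_indic; exact: mJ.
  by apply: measurableT_comp => //; exact: measurable_funB.
apply: eq_integral => w _; rewrite (bigD1 (J w))//= big1 => [|i iJ].
  by rewrite indicE mem_set ?mul1r ?adde0.
by rewrite indicE memNset ?mul0r// => /= Ji; move: iJ; rewrite -Ji eqxx.
Qed.

End random_index.

(** * The distribution function of the zero biased law *)

Section zero_biased_cdf.
Context {R : realType}.

(** An antiderivative of the indicator of []-oo, x[]. As a test function in the zero bias identity
    it yields [P (Xs < x)] on one side, up to a possible atom at [x], and [E X (X - x) 1(X <= x)] on
    the other when the variance is [1]. *)
Definition kink (x u : R) : R := Num.min (u - x) 0.

Lemma kinkE (x u : R) : kink x u = (u - x) * \1_`]-oo, x] u.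
Proof.
rewrite /kink indicE mem_setE in_itv/=; case: (leP u x) => ux.
  by rewrite mulr1 min_l// subr_le0.
by rewrite mulr0 min_r// subr_ge0 ltW.
Qed.

Lemma kink_incr (x u v : R) : u <= v -> 0 <= kink x v - kink x u <= v - u.
Proof.
move=> uv; rewrite /kink.
by case: (leP (v - x) 0) => vx; case: (leP (u - x) 0) => ux; lra.
Qed.

Lemma kink_lipschitz (x u v : R) : `|kink x v - kink x u| <= 1 * `|v - u|.
Proof.
wlog uv : u v / u <= v => [hw|].
  have [|/ltW vu] := leP u v; first exact: hw.
  by rewrite distrC (distrC v); exact: hw.
have /andP[k0 k1] := kink_incr x uv.
by rewrite mul1r !ger0_norm// subr_ge0.
Qed.

Lemma kink_shift_lipschitz (x y u : R) : `|kink x u - kink y u| <= `|x - y|.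
Proof.
have := kink_lipschitz 0 (u - y) (u - x); rewrite mul1r /kink !subr0.
by rewrite (_ : u - x - (u - y) = - (x - y)) ?normrN//; ring.
Qed.

Lemma derive1_kink_lt (x u : R) : u < x -> derive1 (kink x) u = 1.
Proof.
move=> ux; rewrite derive1E.
have d : is_derive u 1 (fun z => z - x) 1.
  by apply: is_derive_eq; rewrite subr0.
apply: derive_val; apply: near_eq_is_derive d => //.
near=> z; rewrite /kink min_l// subr_le0 ltW//.
by near: z; exact: lt_nbhsl.
Unshelve. all: end_near. Qed.

Lemma derive1_kink_gt (x u : R) : x < u -> derive1 (kink x) u = 0.
Proof.
move=> xu; rewrite derive1E.
have d : is_derive u 1 (cst (0 : R)) 0 by exact: is_derive_cst.
apply: derive_val; apply: near_eq_is_derive d => //.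
near=> z; rewrite /kink min_r// subr_ge0 ltW//.
by near: z; exact: lt_nbhsr.
Unshelve. all: end_near. Qed.

(** Also at the kink [u = x], where the derivative is a default value. *)
Lemma derive1_kink_bounds (x u : R) : 0 <= derive1 (kink x) u <= 1.
Proof.
rewrite derive1E /derive.
have q h : 0 <= h^-1 *: ((kink x \o shift u) (h *: 1) - kink x u) <= 1.
  rewrite /= /GRing.scale/= mulr1.
  have [h0|h0|->] := ltgtP h 0; last by rewrite invr0 mul0r lexx ler01.
    have hu : h + u <= u by rewrite gerDr ltW.
    have := kink_incr x hu; rewrite opprD addrCA subrr addr0 => /andP[k0 k1].
    rewrite -mulrNN -invrN opprB.
    by rewrite mulr_ge0 ?invr_ge0 ?oppr_ge0 ?(ltW h0)//= ler_pdivrMl ?mulr1 ?oppr_gt0.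
  have hu : u <= h + u by rewrite lerDr ltW.
  have := kink_incr x hu; rewrite addrK => /andP[k0 k1].
  by rewrite mulr_ge0 ?invr_ge0 ?(ltW h0)//= ler_pdivrMl ?mulr1.
have [cv|dv] := pselect (cvg (h^-1 *: ((kink x \o shift u) (h *: 1) - kink x u) @[h --> 0^'])).
  apply/andP; split; [apply: limr_ge|apply: limr_le] => //; near=> h.
    by have /andP[] := q h.
  by have /andP[] := q h.
(* If the difference quotients have no limit, [lim] takes the default value [point], which is [0] in
   [R]. *)
by rewrite dvgP// -[point]/(0 : R) lexx ler01.
Unshelve. all: end_near. Qed.

Lemma measurable_derive1_kink (x : R) : measurable_fun setT (derive1 (kink x)).
Proof.
rewrite (_ : derive1 (kink x) =
    fun u => \1_`]-oo, x[ u + derive1 (kink x) x * \1_[set x] u).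
  apply: measurable_funD; first exact: measurable_indic.
  by apply: measurable_funM => //; exact: measurable_indic.
apply/funext => u; rewrite !indicE mem_setE in_itv/=.
have [ux|xu|->] := ltgtP u x.
- rewrite derive1_kink_lt// memNset ?mulr0 ?addr0// => /= ux'.
  by move: ux; rewrite ux' ltxx.
- rewrite derive1_kink_gt// memNset ?mulr0 ?addr0// => /= ux'.
  by move: xu; rewrite ux' ltxx.
- by rewrite mem_set// mulr1 add0r.
Qed.

Context d (T : measurableType d) (P : probability T R).
Context d' (T' : measurableType d') (P' : probability T' R).

(** A priori [Xs] may have an atom at [x], exactly where the derivative of [kink x] is a default
    value. Knowing only that this value lies in [[0, 1]] gives [Psi x <= cdf Xs x <= Psi z] for
    every [z > x], and the Lipschitz continuity of [Psi] closes the gap. *)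
Lemma zero_biased_cdf (X : {RV P >-> R}) (Xs : {RV P' >-> R}) (x : R) :
  (X : T -> R) \in Lfun P 2%:E -> ('V_P[X] = 1)%E -> zero_biased X Xs ->
  cdf Xs x = 'E_P[fun w => (X w * (X w - x) * \1_`]-oo, x] (X w))%R]%E.
Proof.
move=> X2 V1 zX.
have iX : P.-integrable setT (EFin \o X).
  apply/Lfun1_integrable; apply: Lfun_subset12 X2.
  by rewrite fin_num_measure.
have iX2 : P.-integrable setT (fun w => (X w ^+ 2)%:E) by exact: Lfun2_integrable_sqr.
have iXk y : P.-integrable setT (EFin \o (fun w => X w * kink y (X w))).
  have iZ := integrableZl measurableT `|y| (integrable_norm iX).
  apply: le_integrable (integrableD measurableT iX2 iZ) => //.
    apply/measurable_EFinP; apply: measurable_funM => //; apply: measurableT_comp => //.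
    by apply: continuous_measurable_fun; exact: lipschitz_continuous (kink_lipschitz y).
  move=> w _ /=; rewrite lee_fin normrM [leRHS]ger0_norm; last first.
    by rewrite addr_ge0 ?sqr_ge0// mulr_ge0.
  have := kink_lipschitz y y (X w).
  rewrite {2}/kink subrr minxx subr0 mul1r => /(ler_wpM2l (normr_ge0 (X w))).
  move/le_trans; apply.
  rewrite (le_trans (ler_wpM2l (normr_ge0 _) (ler_normB _ _)))//.
  by rewrite mulrDr -normrM -expr2 ger0_norm ?sqr_ge0// [X in _ + X]mulrC.
pose Psi y := \int[P]_w (X w * kink y (X w)).
have mXs y : measurable_fun setT (fun w => (derive1 (kink y) (Xs w))%:E).
  apply/measurable_EFinP; apply: measurableT_comp => //.
  exact: measurable_derive1_kink.
have dk y : (\int[P']_w (derive1 (kink y) (Xs w))%:E = (Psi y)%:E)%E.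
  rewrite /Psi /Rintegral fineK; last exact: integrable_fin_num (iXk y).
  have := zX (kink y) (lipschitz_abs_continuous (kink_lipschitz y)) (iXk y).
  rewrite V1 mul1e !expectation.unlock => -> //.
  apply: (@integrable_bounded _ _ _ _ _ 1) => [|w].
    by apply: measurableT_comp => //; exact: measurable_derive1_kink.
  by have /andP[k0 k1] := derive1_kink_bounds y (Xs w); rewrite ger0_norm.
have mstep y : measurable_fun setT (fun w => ((Xs w <= y)%R%:R : R)%:E).
  by apply/measurable_EFinP; exact: measurable_step.
have k0 y w : (0 <= (derive1 (kink y) (Xs w))%:E)%E.
  by rewrite lee_fin; have /andP[] := derive1_kink_bounds y (Xs w).
have lek y : ((Psi y)%:E <= cdf Xs y)%E.
  rewrite -dk cdf_integral; apply: ge0_le_integral => //.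
  move=> w _; rewrite lee_fin; case: (leP (Xs w) y) => h.
    by have /andP[] := derive1_kink_bounds y (Xs w).
  by rewrite derive1_kink_gt.
have gek y z : y < z -> (cdf Xs y <= (Psi z)%:E)%E.
  move=> yz; rewrite -dk cdf_integral; apply: ge0_le_integral => //.
  move=> w _; rewrite lee_fin; case: (leP (Xs w) y) => h.
    by rewrite derive1_kink_lt// (le_lt_trans h).
  by have /andP[] := derive1_kink_bounds z (Xs w).
pose C := \int[P]_w `|X w|.
have C0 : 0 <= C by apply: Rintegral_ge0.
have PsiL y z : `|Psi y - Psi z| <= C * `|y - z|.
  have iB := integrableB measurableT (iXk y) (iXk z).
  rewrite -RintegralB// (le_trans (le_normr_Rintegral _ iB))//.
  rewrite -RintegralZr//; last exact: integrable_norm.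
  apply: le_Rintegral => //.
  - exact: integrable_norm iB.
  - exact: integrableZr (integrable_norm iX).
  - by move=> w _; rewrite -mulrBr normrM ler_wpM2l// kink_shift_lipschitz.
transitivity (Psi x)%:E; last first.
  rewrite unlock /Psi /Rintegral fineK; last exact: integrable_fin_num (iXk x).
  by apply: eq_integral => w _; rewrite kinkE mulrA.
apply/eqP; rewrite eq_le lek andbT -(fineK (fin_num_cdf Xs x)) lee_fin.
apply/ler_addgt0Pr => e e0.
(* Take [z = x + e / (C + 1)]: as [Psi] is [C]-Lipschitz, moving from [x] to [z] costs at most
   [C * e / (C + 1) <= e]. *)
have C1 : 0 < C + 1 by rewrite ltr_wpDl.
have e1 : 0 < e / (C + 1) by rewrite divr_gt0.
have xe : x < x + e / (C + 1) by rewrite ltrDl.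
have := gek _ _ xe; rewrite -(fineK (fin_num_cdf Xs x)) lee_fin => /le_trans; apply.
have := PsiL (x + e / (C + 1)) x.
rewrite addrAC subrr add0r (gtr0_norm e1) => /(le_trans (ler_norm _)).
rewrite lerBlDl => /le_trans; apply; rewrite lerD2l.
by rewrite mulrA ler_pdivrMr// mulrC ler_pM2l// lerDl.
Qed.

End zero_biased_cdf.

(** * The three L1 bounds and the explicit distribution function *)

Local Open Scope ereal_scope.

Theorem theorem2p1 (R : realType) (d : measure_display) (T : measurableType d)
    (P : probability T R) (n : nat) (X : 'I_n -> {RV P >-> R}) :
  (mutually_independent X ->
   (forall i, (X i : T -> R) \in Lfun P 2%:E) ->
   (forall i, 'E_P[X i] = 0) ->
   \sum_(i < n) 'V_P[X i] = 1 ->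
   forall W : {RV P >-> R}, (forall w, W w = (\sum_(i < n) X i w)%R) ->
   (forall (Xstar : 'I_n -> {RV P >-> R}) (J : T -> 'I_n),
      (forall i, zero_biased (X i) (Xstar i)) ->
      (forall i, independent_of_family (Xstar i) [set j | j != i] X) ->
      random_index J ->
      index_independent_of_family J
        (fun k : 'I_n + 'I_n =>
           match k with inl i => X i | inr i => Xstar i end) ->
      (forall i, P (J @^-1` [set i]) = 'V_P[X i]) ->
      L1dist (cdf W) (@std_normal_cdf R) <=
        2%:E * 'E_P[fun w => `|Xstar (J w) w - X (J w) w|%R])
   /\
   (forall (d' : measure_display) (T' : measurableType d')
      (P' : probability T' R) (Xstar : 'I_n -> {RV P' >-> R}),
      (forall i, zero_biased (X i) (Xstar i)) ->
      L1dist (cdf W) (@std_normal_cdf R) <=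
        2%:E * \sum_(i < n)
          ('V_P[X i] * L1dist (cdf (Xstar i)) (cdf (X i)))))
  /\
  (forall X0 : {RV P >-> R},
   (0 < n)%N ->
   mutually_independent X ->
   (forall i, same_law (X i) X0) ->
   (X0 : T -> R) \in Lfun P 2%:E ->
   'E_P[X0] = 0 ->
   'V_P[X0] = 1 ->
   forall W : {RV P >-> R},
   (forall w, W w = ((Num.sqrt n%:R)^-1 * \sum_(i < n) X i w)%R) ->
   forall (d' : measure_display) (T' : measurableType d')
     (P' : probability T' R) (Xstar : {RV P' >-> R}),
     zero_biased X0 Xstar ->
     L1dist (cdf W) (@std_normal_cdf R) <=
       (2 / Num.sqrt n%:R)%:E * L1dist (cdf Xstar) (cdf X0)
     /\
     (forall x : R,
        cdf Xstar x =
          'E_P[fun w => (X0 w * (X0 w - x) * \1_`]-oo, x] (X0 w))%R])).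
Proof.
have P1fin : P [set: T] \is a fin_num by exact: fin_num_measure.
have iLfun (Y : {RV P >-> R}) : (Y : T -> R) \in Lfun P 2%:E ->
    P.-integrable setT (EFin \o Y).
  by move=> Y2; apply/Lfun1_integrable; exact: Lfun_subset12 Y2.
split=> [indX X2 _ sumV W WE|X0 n0 indX sameX X02 EX0 VX0 W WE d' T' P' Xs zX0].
  have bound d' (T' : measurableType d') (P' : probability T' R)
      (Xs : 'I_n -> {RV P' >-> R}) : (forall i, zero_biased (X i) (Xs i)) ->
      L1dist (cdf W) (@std_normal_cdf R) <=
      2%:E * \sum_(i < n) ('V_P[X i] * L1dist (cdf (Xs i)) (cdf (X i))).
    move=> zX; rewrite ge0_sume_distrr; last first.
      by move=> i _; rewrite mule_ge0 ?variance_ge0//; exact: integral_ge0.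
    have := @stein_zero_bias_bound _ _ _ _ _ _ _ n X 1 W Xs indX.
    rewrite !expr1n mulr1; apply => //.
    - by move=> i; exact: iLfun.
    - by move=> i; exact: variance_fin_num.
    - apply: EFin_inj; rewrite -sumEFin -sumV; apply: eq_bigr => i _.
      by rewrite mul1r fineK// variance_fin_num.
    - by move=> w; rewrite WE mul1r.
  split=> [Xs J zX _ mJ indJ PJ|d' T' P' Xs zX]; last exact: bound.
  apply: (le_trans (bound _ _ _ _ zX)).
  rewrite lee_pmul2l// (expectation_random_index _ _ mJ).
  (* Reading the variance as the probability of [J = i] lets each term be estimated on that event
     alone. *)
  apply: lee_sum => i _; rewrite -PJ.
  exact: prob_index_L1dist_le.
split; last by move=> x; exact: zero_biased_cdf.
have iX i : P.-integrable setT (EFin \o X i).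
  exact: (integrable_same_law (same_law_sym (sameX i)) (f := id)) (iLfun _ X02).
have VX i : 'V_P[X i] = 1 by rewrite (variance_same_law (sameX i)).
have c0 : (0 < (Num.sqrt n%:R)^-1 :> R)%R by rewrite invr_gt0 sqrtr_gt0 ltr0n.
have c2 : ((Num.sqrt n%:R)^-1 ^+ 2 = n%:R^-1 :> R)%R by rewrite exprVn sqr_sqrtr.
have nn0 : (n%:R != 0 :> R)%R by rewrite pnatr_eq0 -lt0n.
(* The zero bias property depends on the law of the first variable, so a single [Xs] serves all
   summands. *)
have zX i : zero_biased (X i) Xs.
  exact: zero_biased_same_law (same_law_sym (sameX i)) (iLfun _ X02) zX0.
have Vfin i : 'V_P[X i] \is a fin_num by rewrite VX.
have sumV : (\sum_(i < n) (Num.sqrt n%:R)^-1 ^+ 2 * fine 'V_P[X i] = 1 :> R)%R.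
  under eq_bigr do rewrite VX mulr1 c2.
  by rewrite sumr_const card_ord -[LHS]mulr_natl divff.
have := stein_zero_bias_bound indX iX Vfin c0 sumV WE zX.
under eq_bigr do rewrite VX mul1e (cdf_same_law (sameX _)).
rewrite -ge0_sume_distrl; last first.
  by move=> i _; rewrite lee_fin mulr_ge0// exprn_ge0// ltW.
(* The sum of [n] equal terms [2 * c * c ^+ 2] is [2 * c], because [c ^+ 2] is the inverse of
   [n]. *)
rewrite sumEFin sumr_const card_ord exprS c2.
rewrite (_ : _ *+ n = 2 / Num.sqrt n%:R)%R// -[LHS]mulr_natl.
by field; rewrite nn0 gt_eqF// sqrtr_gt0 ltr0n.
Qed.
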